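(* Assume $J$ with domain $\mathcal F(\Gamma)$ is not essentially selfadjoint in $\ell^2(\Gamma)$. Fix a vertex $x_0$ with $\ell(x_0)=0$ and a nonreal $z\in\mathbb C$. Let $u:\Gamma\to\mathbb C$ satisfy $u\neq0$, $u(x_0)=0$ and $(Ju)(x)=zu(x)$ for all $x\neq x_0$. Then $u\in\ell^2(\Gamma)$.
   Context: Let $\Gamma$ be an infinite connected tree whose vertices are arranged in levels $\ell(x)\in\{0,1,2,\dots\}$: every vertex $x$ is adjacent to exactly one vertex $x'$ with $\ell(x')=\ell(x)+1$; for $\ell(x)\ge 1$ the set $N_x=\{y:\ y'=x\}$ of neighbours of $x$ on level $\ell(x)-1$ is finite and nonempty; $N_x=\emptyset$ if $\ell(x)=0$; there are no other edges. Fix $\lambda_x>0$, $\beta_x\in\mathbb R$. The Jacobi matrix $J$ acts on functions $v:\Gamma\to\mathbb C$ by $(Jv)(x)=\lambda_x v(x')+\beta_x v(x)+\sum_{y\in N_x}\lambda_y v(y)$. $\mathcal F(\Gamma)$ denotes the finitely supported functions; $J$ with domain $\mathcal F(\Gamma)$ is symmetric in $\ell^2(\Gamma)$. *)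

(* Defs.v *)
From Stdlib Require Import Reals List.
Import ListNotations.
Open Scope R_scope.

Record Cplx := mkC { re : R; im : R }.
Definition C0 : Cplx := mkC 0 0.
Definition RtoC (r : R) : Cplx := mkC r 0.
Definition Cadd (a b : Cplx) : Cplx := mkC (re a + re b) (im a + im b).
Definition Copp (a : Cplx) : Cplx := mkC (- re a) (- im a).
Definition Csub (a b : Cplx) : Cplx := Cadd a (Copp b).
Definition Cmul (a b : Cplx) : Cplx :=
  mkC (re a * re b - im a * im b) (re a * im b + im a * re b).
Definition Cconj (a : Cplx) : Cplx := mkC (re a) (- im a).
Definition Cnorm2 (a : Cplx) : R := re a * re a + im a * im a.

Definition Csum_list {V : Type} (f : V -> Cplx) (L : list V) : Cplx :=
  fold_right (fun x acc => Cadd (f x) acc) C0 L.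
Definition Rsum_list {V : Type} (f : V -> R) (L : list V) : R :=
  fold_right (fun x acc => f x + acc) 0 L.

(* ---------- The leveled tree Gamma ----------
   Vertices: type V; level lvl; par x = x' (the unique neighbour one level up);
   kids x = N_x (neighbours one level down), a finite duplicate-free list.
   Since lvl (par x) = lvl x + 1, N_x is empty on level 0 automatically and
   Gamma is automatically infinite (the chain x, x', x'', ... is injective). *)
Definition leveled_tree {V : Type} (lvl : V -> nat) (par : V -> V)
  (kids : V -> list V) : Prop :=
  (forall x, lvl (par x) = S (lvl x)) /\
  (forall x y, In y (kids x) <-> par y = x) /\
  (forall x, NoDup (kids x)) /\
  (forall x, (1 <= lvl x)%nat -> kids x <> []) /\
  (* connectedness: any two vertices have a common ancestor *)
  (forall x y, exists n m, Nat.iter n par x = Nat.iter m par y).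

Definition Japp {V : Type} (par : V -> V) (kids : V -> list V)
  (lam beta : V -> R) (v : V -> Cplx) (x : V) : Cplx :=
  Cadd (Cadd (Cmul (RtoC (lam x)) (v (par x))) (Cmul (RtoC (beta x)) (v x)))
       (Csum_list (fun y => Cmul (RtoC (lam y)) (v y)) (kids x)).

Definition finsupp {V : Type} (v : V -> Cplx) : Prop :=
  exists L : list V, forall x, ~ In x L -> v x = C0.

Definition in_l2 {V : Type} (v : V -> Cplx) : Prop :=
  exists B : R, forall L : list V, NoDup L -> Rsum_list (fun x => Cnorm2 (v x)) L <= B.

Definition l2_close {V : Type} (v w : V -> Cplx) (eps : R) : Prop :=
  forall L : list V, NoDup L -> Rsum_list (fun x => Cnorm2 (Csub (v x) (w x))) L <= eps.

Definition has_sum {V : Type} (h : V -> Cplx) (s : Cplx) : Prop :=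
  forall eps, 0 < eps -> exists L0 : list V, NoDup L0 /\
    forall L, NoDup L -> incl L0 L -> Cnorm2 (Csub (Csum_list h L) s) < eps.

Definition graph (V : Type) := (V -> Cplx) -> (V -> Cplx) -> Prop.

Definition Jmin {V : Type} (par : V -> V) (kids : V -> list V) (lam beta : V -> R)
  : graph V :=
  fun f g => finsupp f /\ forall x, g x = Japp par kids lam beta f x.

Definition closure {V : Type} (T : graph V) : graph V :=
  fun f g => in_l2 f /\ in_l2 g /\
    forall eps, 0 < eps -> exists f' g', T f' g' /\ l2_close f f' eps /\ l2_close g g' eps.

(* Hilbert-space adjoint, inner product <a,b> = sum_x a x * conj (b x):
   T* v = w  iff  <T f, v> = <f, w> for all (f, T f) in the graph of T *)
Definition adjoint {V : Type} (T : graph V) : graph V :=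
  fun v w => in_l2 v /\ in_l2 w /\
    forall f g, T f g -> exists s,
      has_sum (fun x => Cmul (g x) (Cconj (v x))) s /\
      has_sum (fun x => Cmul (f x) (Cconj (w x))) s.

Definition ess_selfadjoint {V : Type} (T : graph V) : Prop :=
  forall v w, closure T v w <-> adjoint (closure T) v w.

(* Main.v *)
Require Import Defs.
From Stdlib Require Import Reals List Psatz Permutation ClassicalEpsilon IndefiniteDescription.
Import ListNotations.
Open Scope R_scope.

(** The equation [J phi = z phi], solved upwards from level 0, fixes the ratios
    [r x = phi (par x) / phi x] by a continued fraction in which [Im z * Im (r x) > 0]
    persists; hence it has, up to scalars, exactly one solution [phi], and [phi] vanishes
    nowhere.  If [phi] were not in l2, then [J - z] would have dense range on finitely
    supported functions and no l2 kernel, which forces essential selfadjointness.  So [phi]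
    is in l2.  Finally, on the descendants of a vertex [x] above [x0], write
    [u = psi + a phi] with [psi (par x) = 0]: then [(J - z) psi] is, on these descendants,
    a multiple [c] of the delta function at [x0] that does not depend on [x], so the norm
    of [psi] is at most [|c| / |Im z|]; since [u x0 = 0], this bounds [a] as well, and
    with it the norm of [u], uniformly in [x]. *)

(** * Complex numbers *)

(** A branch, that is a vertex with all its descendants, is finite and meets the rest of the tree
    only through the parent of its top vertex. A function vanishing at that parent can be cut off to
    the branch at the price of one error term there, and [(J - z) f = g] on the branch is solvable
    by elimination. This replaces spectral theory by finite sums. In general, density of the range
    of [J - z] is governed by the kernel at the conjugate of [z], while uniqueness concerns [z]
    itself; here the coefficients are real, conjugation exchanges the two, and the single function
    [phi] settles both. Norms appear squared throughout, to avoid square roots; the factors 2 and 4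
    in the estimates come from |a + b|^2 <= 2 |a|^2 + 2 |b|^2. *)

Definition Cone : Cplx := mkC 1 0.
Definition Cinv (a : Cplx) : Cplx := mkC (re a / Cnorm2 a) (- im a / Cnorm2 a).
Definition Cdiv (a b : Cplx) : Cplx := Cmul a (Cinv b).

Lemma Cplx_ext (a b : Cplx) : re a = re b -> im a = im b -> a = b.
Proof. destruct a, b; simpl; intros; subst; reflexivity. Qed.

Lemma Cnorm2_ge0 (a : Cplx) : 0 <= Cnorm2 a.
Proof. unfold Cnorm2; nra. Qed.

Lemma Cnorm2_eq0 (a : Cplx) : Cnorm2 a = 0 -> a = C0.
Proof. unfold Cnorm2; intros H; apply Cplx_ext; simpl; nra. Qed.

Lemma Cnorm2_gt0 (a : Cplx) : a <> C0 -> 0 < Cnorm2 a.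
Proof.
  intros Ha. destruct (Cnorm2_ge0 a) as [H|H]; [exact H|].
  exfalso. apply Ha, Cnorm2_eq0. now rewrite <- H.
Qed.

Lemma Cnorm2_C0 : Cnorm2 C0 = 0.
Proof. unfold Cnorm2; simpl; ring. Qed.

Lemma Cplx_field : field_theory C0 Cone Cadd Cmul Csub Copp Cdiv Cinv eq.
Proof.
  split; [split| | |]; intros; try (apply Cplx_ext; simpl; ring); try reflexivity.
  - intros H. apply (f_equal re) in H. simpl in H. lra.
  - pose proof (Cnorm2_gt0 _ H) as Hp.
    apply Cplx_ext; unfold Cinv; simpl; unfold Cnorm2 in *; field; lra.
Qed.
Add Field Cplx_field : Cplx_field.

Lemma Cmul_eq0 (a b : Cplx) : Cmul a b = C0 -> b <> C0 -> a = C0.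
Proof.
  intros H Hb. replace a with (Cmul (Cmul a b) (Cinv b)) by (field; exact Hb).
  rewrite H. ring.
Qed.

Lemma Cmul_neq0 (a b : Cplx) : a <> C0 -> b <> C0 -> Cmul a b <> C0.
Proof. intros Ha Hb H. apply Ha. exact (Cmul_eq0 _ _ H Hb). Qed.

Lemma Cinv_neq0 (a : Cplx) : a <> C0 -> Cinv a <> C0.
Proof.
  intros Ha H. apply Ha. replace a with (Cmul (Cmul a a) (Cinv a)) by (field; exact Ha).
  rewrite H. ring.
Qed.

Lemma Cnorm2_mul (a b : Cplx) : Cnorm2 (Cmul a b) = Cnorm2 a * Cnorm2 b.
Proof. unfold Cnorm2; simpl; ring. Qed.

Lemma Cnorm2_conj (a : Cplx) : Cnorm2 (Cconj a) = Cnorm2 a.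
Proof. unfold Cnorm2; simpl; ring. Qed.

Lemma Cnorm2_sub_sym (a b : Cplx) : Cnorm2 (Csub a b) = Cnorm2 (Csub b a).
Proof. unfold Cnorm2; simpl; ring. Qed.

Lemma Cnorm2_add_le (a b : Cplx) : Cnorm2 (Cadd a b) <= 2 * Cnorm2 a + 2 * Cnorm2 b.
Proof.
  unfold Cnorm2; simpl.
  pose proof (Rle_0_sqr (re a - re b)); pose proof (Rle_0_sqr (im a - im b)).
  unfold Rsqr in *; lra.
Qed.

Lemma Cnorm2_tri (a b c : Cplx) :
  Cnorm2 (Csub a c) <= 2 * Cnorm2 (Csub a b) + 2 * Cnorm2 (Csub b c).
Proof.
  replace (Csub a c) with (Cadd (Csub a b) (Csub b c)) by ring. apply Cnorm2_add_le.
Qed.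

Lemma Ceq_of_close (a b : Cplx) :
  (forall eps, 0 < eps -> Cnorm2 (Csub a b) <= eps) -> a = b.
Proof.
  intros H. assert (Cnorm2 (Csub a b) = 0).
  { destruct (Cnorm2_ge0 (Csub a b)) as [Hp|Hp]; [|lra].
    specialize (H (Cnorm2 (Csub a b) / 2)). lra. }
  apply Cnorm2_eq0 in H0. replace a with (Cadd (Csub a b) b) by ring.
  rewrite H0. ring.
Qed.

Lemma RtoC_neq0 (r : R) : 0 < r -> RtoC r <> C0.
Proof. intros Hr H. apply (f_equal re) in H. simpl in H. lra. Qed.

(** * Finite sums and square-summable functions *)

Section Sums.
Context {V : Type}.
Implicit Types (L M : list V) (f g h : V -> Cplx).

(** [V] has no decidable equality, so membership and equality are decided classically; this makes
    cut-offs and [nodup] available. *)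
Definition dec_in (x : V) L : {In x L} + {~ In x L} :=
  excluded_middle_informative (In x L).

Definition dec_eq (x y : V) : {x = y} + {x <> y} :=
  excluded_middle_informative (x = y).

Definition restr L f (x : V) : Cplx := if dec_in x L then f x else C0.

Lemma restr_in L f x : In x L -> restr L f x = f x.
Proof. unfold restr; destruct (dec_in x L); tauto. Qed.

Lemma restr_out L f x : ~ In x L -> restr L f x = C0.
Proof. unfold restr; destruct (dec_in x L); tauto. Qed.

Lemma Csum_ext f g L : (forall x, In x L -> f x = g x) -> Csum_list f L = Csum_list g L.
Proof.
  induction L as [|a L IH]; simpl; intros H; [reflexivity|].
  rewrite (H a), IH; auto.
Qed.

Lemma Csum_add f g L :
  Csum_list (fun x => Cadd (f x) (g x)) L = Cadd (Csum_list f L) (Csum_list g L).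
Proof. induction L as [|a L IH]; simpl; [ring|rewrite IH; ring]. Qed.

Lemma Csum_scal c f L : Csum_list (fun x => Cmul c (f x)) L = Cmul c (Csum_list f L).
Proof. induction L as [|a L IH]; simpl; [ring|rewrite IH; ring]. Qed.

Lemma Csum_sub f g L :
  Csum_list (fun x => Csub (f x) (g x)) L = Csub (Csum_list f L) (Csum_list g L).
Proof. induction L as [|a L IH]; simpl; [ring|rewrite IH; ring]. Qed.

Lemma Csum_conj f L : Csum_list (fun x => Cconj (f x)) L = Cconj (Csum_list f L).
Proof.
  induction L as [|a L IH]; simpl; [apply Cplx_ext; simpl; ring|].
  rewrite IH. apply Cplx_ext; simpl; ring.
Qed.

Lemma Csum_zero f L : (forall x, In x L -> f x = C0) -> Csum_list f L = C0.
Proof.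
  induction L as [|a L IH]; simpl; intros H; [reflexivity|].
  rewrite (H a), IH; auto. ring.
Qed.

Lemma Csum_re f L : re (Csum_list f L) = Rsum_list (fun x => re (f x)) L.
Proof. induction L; simpl; congruence. Qed.

Lemma Csum_im f L : im (Csum_list f L) = Rsum_list (fun x => im (f x)) L.
Proof. induction L; simpl; congruence. Qed.

Lemma Csum_RtoC (p : V -> R) L : Csum_list (fun x => RtoC (p x)) L = RtoC (Rsum_list p L).
Proof.
  induction L as [|a L IH]; simpl; [reflexivity|]. rewrite IH. apply Cplx_ext; simpl; ring.
Qed.

Lemma Csum_perm f L M : Permutation L M -> Csum_list f L = Csum_list f M.
Proof.
  induction 1; simpl; [reflexivity|rewrite IHPermutation; ring|ring|congruence].
Qed.

Lemma Csum_app f L M : Csum_list f (L ++ M) = Cadd (Csum_list f L) (Csum_list f M).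
Proof. induction L as [|a L IH]; simpl; [ring|rewrite IH; ring]. Qed.

(** Once the zero terms are filtered out, the two lists are permutations of each other. *)
Lemma Csum_supp f L M : NoDup L -> NoDup M ->
  (forall x, f x <> C0 -> (In x L <-> In x M)) -> Csum_list f L = Csum_list f M.
Proof.
  intros HL HM H.
  set (p := fun x => if excluded_middle_informative (f x = C0) then false else true).
  assert (Hp : forall N, Csum_list f N = Csum_list f (filter p N)).
  { induction N as [|a N IH]; simpl; [reflexivity|].
    unfold p at 1. destruct excluded_middle_informative as [e|e]; simpl; rewrite IH.
    - rewrite e. ring.
    - reflexivity. }
  rewrite (Hp L), (Hp M). apply Csum_perm, NoDup_Permutation; auto using NoDup_filter.
  intros x. rewrite !filter_In. unfold p.
  destruct excluded_middle_informative as [e|e]; [intuition congruence|].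
  specialize (H x e). intuition.
Qed.

Lemma Csum_single f L a : NoDup L -> In a L -> (forall x, In x L -> x <> a -> f x = C0) ->
  Csum_list f L = f a.
Proof.
  intros HL Ha H. rewrite (Csum_ext f (restr [a] f)).
  - rewrite (Csum_supp _ L [a]); auto.
    + simpl. rewrite restr_in by (simpl; auto). ring.
    + repeat constructor; simpl; auto.
    + intros x Hx. destruct (dec_in x [a]) as [i|i].
      * simpl in i. destruct i as [->|[]]. simpl. tauto.
      * now rewrite restr_out in Hx.
  - intros x Hx. destruct (dec_eq x a) as [->|n].
    + rewrite restr_in; simpl; auto.
    + rewrite restr_out; auto. simpl. intros [e|[]]; congruence.
Qed.

Lemma Rsum_ext (f g : V -> R) L :
  (forall x, In x L -> f x = g x) -> Rsum_list f L = Rsum_list g L.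
Proof.
  induction L as [|a L IH]; simpl; intros H; [reflexivity|].
  rewrite (H a), IH; auto.
Qed.

Lemma Rsum_le (f g : V -> R) L :
  (forall x, In x L -> f x <= g x) -> Rsum_list f L <= Rsum_list g L.
Proof.
  induction L as [|a L IH]; simpl; intros H; [lra|].
  specialize (IH (fun x Hx => H x (or_intror Hx))). specialize (H a (or_introl eq_refl)). lra.
Qed.

Lemma Rsum_lin (f g : V -> R) a b L :
  Rsum_list (fun x => a * f x + b * g x) L = a * Rsum_list f L + b * Rsum_list g L.
Proof. induction L as [|c L IH]; simpl; [ring|rewrite IH; ring]. Qed.

Lemma Rsum_scal (f : V -> R) a L : Rsum_list (fun x => a * f x) L = a * Rsum_list f L.
Proof. induction L as [|c L IH]; simpl; [ring|rewrite IH; ring]. Qed.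

Lemma Rsum_ge0 (f : V -> R) L : (forall x, 0 <= f x) -> 0 <= Rsum_list f L.
Proof.
  intros H; induction L as [|a L IH]; simpl; [lra|]. specialize (H a). lra.
Qed.

Lemma Rsum_app (f : V -> R) L M : Rsum_list f (L ++ M) = Rsum_list f L + Rsum_list f M.
Proof. induction L as [|a L IH]; simpl; [ring|rewrite IH; ring]. Qed.

Lemma Rsum_incl (f : V -> R) L M : (forall x, 0 <= f x) -> NoDup L -> incl L M ->
  Rsum_list f L <= Rsum_list f M.
Proof.
  intros Hf HL. revert M. induction HL as [|a L Ha HL IH]; intros M HM; simpl.
  - now apply Rsum_ge0.
  - destruct (in_split a M (HM a (or_introl eq_refl))) as (M1 & M2 & ->).
    assert (Hi : incl L (M1 ++ M2)).
    { intros y Hy. specialize (HM y (or_intror Hy)).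
      rewrite in_app_iff in *; simpl in HM. destruct HM as [?|[->|?]]; tauto. }
    specialize (IH _ Hi). rewrite Rsum_app in *. simpl. lra.
Qed.

Definition nrm2 f L : R := Rsum_list (fun x => Cnorm2 (f x)) L.

Lemma nrm2_ge0 f L : 0 <= nrm2 f L.
Proof. apply Rsum_ge0. intros; apply Cnorm2_ge0. Qed.

Lemma nrm2_incl f L M : NoDup L -> incl L M -> nrm2 f L <= nrm2 f M.
Proof. apply Rsum_incl. intros; apply Cnorm2_ge0. Qed.

Lemma nrm2_ext f g L : (forall x, In x L -> f x = g x) -> nrm2 f L = nrm2 g L.
Proof. intros H. apply Rsum_ext. intros x Hx. now rewrite H. Qed.

Lemma nrm2_add_le f g L :
  nrm2 (fun x => Cadd (f x) (g x)) L <= 2 * nrm2 f L + 2 * nrm2 g L.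
Proof. unfold nrm2. rewrite <- Rsum_lin. apply Rsum_le. intros; apply Cnorm2_add_le. Qed.

Lemma nrm2_tri f g h L :
  nrm2 (fun x => Csub (f x) (h x)) L <=
  2 * nrm2 (fun x => Csub (f x) (g x)) L + 2 * nrm2 (fun x => Csub (g x) (h x)) L.
Proof. unfold nrm2. rewrite <- Rsum_lin. apply Rsum_le. intros; apply Cnorm2_tri. Qed.

Lemma nrm2_scal c f L : nrm2 (fun x => Cmul c (f x)) L = Cnorm2 c * nrm2 f L.
Proof.
  unfold nrm2. rewrite <- Rsum_scal. apply Rsum_ext. intros; apply Cnorm2_mul.
Qed.

Lemma nrm2_conj f L : nrm2 (fun x => Cconj (f x)) L = nrm2 f L.
Proof. apply Rsum_ext. intros; apply Cnorm2_conj. Qed.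

(** Induction on the list. A new term w adds |w|^2 = pq and a cross term 2d with d = Re (s conj w).
    Since d^2 <= |s|^2 |w|^2 <= AB pq and 4 AB pq <= (Aq + Bp)^2, one gets 2d <= Aq + Bp. *)
Lemma Cauchy_Schwarz f g L :
  Cnorm2 (Csum_list (fun x => Cmul (f x) (g x)) L) <= nrm2 f L * nrm2 g L.
Proof.
  induction L as [|a L IH]; [unfold nrm2; simpl; rewrite Cnorm2_C0; lra|].
  change (nrm2 f (a :: L)) with (Cnorm2 (f a) + nrm2 f L).
  change (nrm2 g (a :: L)) with (Cnorm2 (g a) + nrm2 g L).
  pose proof (nrm2_ge0 f L) as HA. pose proof (nrm2_ge0 g L) as HB.
  set (A := nrm2 f L) in *. set (B := nrm2 g L) in *.
  simpl Csum_list. set (s := Csum_list _ L) in *.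
  pose proof (Cnorm2_ge0 (f a)) as Hp. pose proof (Cnorm2_ge0 (g a)) as Hq.
  pose proof (Cnorm2_mul (f a) (g a)) as Hw. set (w := Cmul (f a) (g a)) in *.
  set (p := Cnorm2 (f a)) in *. set (q := Cnorm2 (g a)) in *.
  set (d := re s * re w + im s * im w).
  assert (Hd : Rsqr d <= Cnorm2 s * Cnorm2 w).
  { pose proof (Rle_0_sqr (re s * im w - im s * re w)). unfold Rsqr, d, Cnorm2 in *. lra. }
  assert (Hsw : Cnorm2 s * Cnorm2 w <= A * B * (p * q)).
  { rewrite Hw. apply Rmult_le_compat_r; [|exact IH]. now apply Rmult_le_pos. }
  assert (H2 : Rsqr (2 * d) <= Rsqr (A * q + B * p)).
  { pose proof (Rle_0_sqr (A * q - B * p)). unfold Rsqr in *. nra. }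
  assert (H3 : 2 * d <= A * q + B * p).
  { apply Rsqr_incr_0_var; [exact H2|].
    pose proof (Rmult_le_pos _ _ HA Hq). pose proof (Rmult_le_pos _ _ HB Hp). lra. }
  replace (Cnorm2 (Cadd w s)) with (Cnorm2 s + 2 * d + Cnorm2 w)
    by (unfold d, Cnorm2; simpl; ring).
  rewrite Hw. lra.
Qed.

Lemma l2_add f g : in_l2 f -> in_l2 g -> in_l2 (fun x => Cadd (f x) (g x)).
Proof.
  intros [B HB] [B' HB']. exists (2 * B + 2 * B'). intros L HL.
  pose proof (nrm2_add_le f g L). specialize (HB L HL). specialize (HB' L HL).
  unfold nrm2 in *. lra.
Qed.

Lemma l2_scal c f : in_l2 f -> in_l2 (fun x => Cmul c (f x)).
Proof.
  intros [B HB]. exists (Cnorm2 c * B). intros L HL.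
  change (nrm2 (fun x => Cmul c (f x)) L <= Cnorm2 c * B). rewrite nrm2_scal.
  apply Rmult_le_compat_l; [apply Cnorm2_ge0|]. exact (HB L HL).
Qed.

Lemma l2_ext f g : (forall x, f x = g x) -> in_l2 f -> in_l2 g.
Proof.
  intros H [B HB]. exists B. intros L HL. specialize (HB L HL).
  erewrite Rsum_ext; [exact HB|]. intros; simpl; now rewrite H.
Qed.

Lemma bounded_tail (p : V -> R) B : (forall x, 0 <= p x) ->
  (forall L, NoDup L -> Rsum_list p L <= B) ->
  exists s, (forall L, NoDup L -> Rsum_list p L <= s) /\
    forall eps, 0 < eps -> exists L, NoDup L /\ s - eps < Rsum_list p L.
Proof.
  intros Hp HB.
  destruct (completeness (fun r => exists L, NoDup L /\ r = Rsum_list p L)) as [s [Hs1 Hs2]].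
  - exists B. intros r (L & HL & ->). auto.
  - exists 0, []. split; [constructor|reflexivity].
  - exists s. split.
    + intros L HL. apply Hs1. now exists L.
    + intros eps He. apply NNPP. intros H.
      enough (s <= s - eps) by lra. apply Hs2. intros r (L & HL & ->).
      apply Rnot_lt_le. intros Hlt. apply H. now exists L.
Qed.

Lemma nrm2_supp f S L : NoDup L -> (forall x, ~ In x S -> f x = C0) ->
  nrm2 f L <= nrm2 f S.
Proof.
  intros HL HS.
  enough (nrm2 f L <= nrm2 f (filter (fun x => if dec_in x S then true else false) L)).
  { eapply Rle_trans; [exact H|]. apply nrm2_incl; [now apply NoDup_filter|].
    intros x Hx. apply filter_In in Hx. destruct Hx as [_ Hx].
    destruct (dec_in x S); [auto|discriminate]. }
  clear HL. induction L as [|a L IH]; [simpl; unfold nrm2; simpl; lra|].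
  simpl. destruct (dec_in a S) as [i|i]; unfold nrm2 in *; simpl.
  - lra.
  - rewrite (HS a i), Cnorm2_C0. lra.
Qed.

Lemma l2_finsupp f : finsupp f -> in_l2 f.
Proof. intros [S HS]. exists (nrm2 f S). intros L HL. now apply nrm2_supp. Qed.

(** [M] comes within [eps] of the supremum of the finite sums, so entries outside [M] cannot
    contribute more than [eps]. *)
Lemma l2_tail f eps : in_l2 f -> 0 < eps -> exists M, NoDup M /\
  forall L, NoDup L -> nrm2 (fun x => Csub (restr M f x) (f x)) L <= eps.
Proof.
  intros [B HB] He.
  destruct (bounded_tail (fun x => Cnorm2 (f x)) B) as (s & Hs & Ht);
    [intros; apply Cnorm2_ge0|exact HB|].
  destruct (Ht eps He) as (M & HM & Hlt). exists M. split; [exact HM|]. intros L HL.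
  set (q := fun x => if dec_in x M then false else true).
  assert (Hq : nrm2 (fun x => Csub (restr M f x) (f x)) L = nrm2 f (filter q L)).
  { clear HL. unfold nrm2. induction L as [|a L IH]; simpl; [reflexivity|].
    rewrite IH. unfold q at 2. destruct (dec_in a M) as [i|i]; simpl.
    - rewrite restr_in by exact i. unfold Cnorm2; simpl; ring.
    - rewrite restr_out by exact i. unfold Cnorm2; simpl; ring. }
  rewrite Hq. assert (Hnd : NoDup (filter q L ++ M)).
  { apply NoDup_app; auto using NoDup_filter. intros x Hx Hm.
    apply filter_In in Hx. unfold q in Hx. destruct (dec_in x M); intuition congruence. }
  specialize (Hs _ Hnd). rewrite Rsum_app in Hs. unfold nrm2. lra.
Qed.

(** * Infinite sums and completeness *)

Definition has_sumR (p : V -> R) (s : R) : Prop :=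
  forall eps, 0 < eps -> exists L0 : list V, NoDup L0 /\
    forall L, NoDup L -> incl L0 L -> Rabs (Rsum_list p L - s) < eps.

Lemma has_sumR_nonneg (p : V -> R) B : (forall x, 0 <= p x) ->
  (forall L, NoDup L -> Rsum_list p L <= B) -> exists s, has_sumR p s.
Proof.
  intros Hp HB. destruct (bounded_tail p B Hp HB) as (s & Hs & He).
  exists s. intros eps Heps. destruct (He eps Heps) as (L0 & H0 & Hl).
  exists L0. split; [exact H0|]. intros L HL Hi.
  pose proof (Rsum_incl p _ _ Hp H0 Hi). specialize (Hs L HL).
  apply Rabs_def1; lra.
Qed.

Lemma has_sumR_lin (p q : V -> R) a b s t : has_sumR p s -> has_sumR q t ->
  has_sumR (fun x => a * p x + b * q x) (a * s + b * t).
Proof.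
  intros Hp Hq eps He.
  set (c := 1 + Rabs a + Rabs b).
  assert (Hc : 0 < c) by (unfold c; pose proof (Rabs_pos a); pose proof (Rabs_pos b); lra).
  assert (Hd : 0 < eps / c) by (now apply Rdiv_lt_0_compat).
  destruct (Hp _ Hd) as (L1 & N1 & H1). destruct (Hq _ Hd) as (L2 & N2 & H2).
  exists (nodup dec_eq (L1 ++ L2)). split; [apply NoDup_nodup|].
  intros L HL Hi.
  assert (I1 : incl L1 L) by (intros x Hx; apply Hi, nodup_In, in_or_app; auto).
  assert (I2 : incl L2 L) by (intros x Hx; apply Hi, nodup_In, in_or_app; auto).
  specialize (H1 L HL I1). specialize (H2 L HL I2). rewrite Rsum_lin.
  replace (a * Rsum_list p L + b * Rsum_list q L - (a * s + b * t))
    with (a * (Rsum_list p L - s) + b * (Rsum_list q L - t)) by ring.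
  eapply Rle_lt_trans; [apply Rabs_triang|]. rewrite !Rabs_mult.
  pose proof (Rabs_pos a). pose proof (Rabs_pos b).
  replace eps with (c * (eps / c)) by (field; lra). unfold c at 1.
  set (d := eps / c) in *. nra.
Qed.

Lemma has_sum_of_parts h s t :
  has_sumR (fun x => re (h x)) s -> has_sumR (fun x => im (h x)) t ->
  has_sum h (mkC s t).
Proof.
  (* With d <= 1 and d <= eps / 2, errors below d in both parts give u^2 + v^2 < 2 d^2 <= 2 d <=
     eps. *)
  intros Hs Ht eps He. set (d := Rmin 1 (eps / 2)).
  assert (Hd : 0 < d) by (apply Rmin_glb_lt; lra).
  assert (Hd1 : d <= 1) by apply Rmin_l. assert (Hd2 : d <= eps / 2) by apply Rmin_r.
  destruct (Hs _ Hd) as (L1 & N1 & H1). destruct (Ht _ Hd) as (L2 & N2 & H2).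
  exists (nodup dec_eq (L1 ++ L2)). split; [apply NoDup_nodup|].
  intros L HL Hi.
  assert (I1 : incl L1 L) by (intros x Hx; apply Hi, nodup_In, in_or_app; auto).
  assert (I2 : incl L2 L) by (intros x Hx; apply Hi, nodup_In, in_or_app; auto).
  specialize (H1 L HL I1). specialize (H2 L HL I2).
  unfold Cnorm2; simpl. rewrite Csum_re, Csum_im.
  apply Rabs_def2 in H1. apply Rabs_def2 in H2.
  set (u := Rsum_list _ L - s) in H1. set (v := Rsum_list _ L - t) in H2.
  change (u * u + v * v < eps). nra.
Qed.

(** Polarisation: the real part of f conj g is (|f + g|^2 - |f - g|^2) / 4, and the imaginary part
    is the same expression with i g for g. Each square has bounded finite sums, hence converges. *)
Lemma l2_prod_has_sum f g : in_l2 f -> in_l2 g ->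
  exists s, has_sum (fun x => Cmul (f x) (Cconj (g x))) s.
Proof.
  intros Hf Hg.
  assert (P : forall c, exists s,
    has_sumR (fun x => Cnorm2 (Cadd (f x) (Cmul c (g x)))) s).
  { intros c. destruct (l2_add _ _ Hf (l2_scal c _ Hg)) as [B HB].
    eapply has_sumR_nonneg; [intros; apply Cnorm2_ge0|exact HB]. }
  destruct (P (mkC 1 0)) as [a Ha]. destruct (P (mkC (-1) 0)) as [b Hb].
  destruct (P (mkC 0 1)) as [c Hc]. destruct (P (mkC 0 (-1))) as [d Hd].
  exists (mkC (/4 * a + - /4 * b) (/4 * c + - /4 * d)).
  apply has_sum_of_parts.
  - intros eps He. destruct (has_sumR_lin _ _ (/4) (- /4) _ _ Ha Hb eps He) as (L0 & N & H).
    exists L0. split; [exact N|]. intros L HL Hi. specialize (H L HL Hi).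
    erewrite Rsum_ext; [exact H|]. intros x _. unfold Cnorm2; simpl. field.
  - intros eps He. destruct (has_sumR_lin _ _ (/4) (- /4) _ _ Hc Hd eps He) as (L0 & N & H).
    exists L0. split; [exact N|]. intros L HL Hi. specialize (H L HL Hi).
    erewrite Rsum_ext; [exact H|]. intros x _. unfold Cnorm2; simpl. field.
Qed.

Lemma has_sum_finsupp h s M : NoDup M -> (forall x, ~ In x M -> h x = C0) ->
  has_sum h s -> s = Csum_list h M.
Proof.
  intros HM Hz Hs. apply Ceq_of_close. intros eps He.
  destruct (Hs eps He) as (L0 & N & H).
  specialize (H (nodup dec_eq (L0 ++ M)) (NoDup_nodup _ _)).
  rewrite (Csum_supp h _ M) in H; auto using NoDup_nodup.
  - rewrite Cnorm2_sub_sym. left. apply H. intros x Hx. apply nodup_In, in_or_app; auto.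
  - intros x Hx. rewrite nodup_In, in_app_iff. split; [|auto]. intros _.
    apply NNPP. auto.
Qed.

Lemma Un_cv_Cnorm2 (a : nat -> Cplx) (b c : Cplx) :
  Un_cv (fun n => re (a n)) (re b) -> Un_cv (fun n => im (a n)) (im b) ->
  Un_cv (fun n => Cnorm2 (Csub (a n) c)) (Cnorm2 (Csub b c)).
Proof.
  intros Hr Hi. unfold Cnorm2; simpl.
  assert (K : forall r : R, Un_cv (fun _ => r) r).
  { intros r e He. exists 0%nat. intros. unfold Rdist. rewrite Rminus_diag, Rabs_R0. lra. }
  apply CV_plus; apply CV_mult; apply CV_plus; auto.
Qed.

Lemma Un_cv_le_eventually (a : nat -> R) (l c : R) (k : nat) :
  Un_cv a l -> (forall n, (k <= n)%nat -> a n <= c) -> l <= c.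
Proof.
  intros Ha H. apply Rnot_lt_le. intros Hlt.
  destruct (Ha (l - c)) as [N HN]; [lra|].
  specialize (HN (max N k) (Nat.le_max_l _ _)). specialize (H (max N k) (Nat.le_max_r _ _)).
  unfold Rdist in HN. apply Rabs_def2 in HN. lra.
Qed.

(** The Cauchy bound on one-element lists gives a pointwise limit; on a fixed finite list the bound
    [e k] then survives j -> infinity. *)
Lemma l2_complete (F : nat -> V -> Cplx) (e : nat -> R) :
  Un_cv e 0 ->
  (forall j k L, (k <= j)%nat -> NoDup L ->
     nrm2 (fun x => Csub (F j x) (F k x)) L <= e k) ->
  exists f, forall k L, NoDup L -> nrm2 (fun x => Csub (f x) (F k x)) L <= e k.
Proof.
  intros He HF.
  assert (Hpt : forall x j k, (k <= j)%nat -> Cnorm2 (Csub (F j x) (F k x)) <= e k).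
  { intros x j k Hjk. specialize (HF j k [x] Hjk). unfold nrm2 in HF; simpl in HF.
    rewrite Rplus_0_r in HF. apply HF. repeat constructor; simpl; auto. }
  assert (Hc : forall (part : Cplx -> R),
    (forall a b, (part a - part b) * (part a - part b) <= Cnorm2 (Csub a b)) ->
    forall x, Cauchy_crit (fun n => part (F n x))).
  { intros part Hpart x eps Heps.
    destruct (He (eps / 2 * (eps / 2))) as [N HN]; [nra|]. exists N.
    assert (Hn : forall n, (n >= N)%nat -> Rabs (part (F n x) - part (F N x)) < eps / 2).
    { intros n Hn. specialize (Hpt x n N Hn).
      pose proof (Hpart (F n x) (F N x)) as H1. specialize (HN N (le_n _)).
      unfold Rdist in HN. apply Rabs_def2 in HN.
      apply Rabs_def1; apply Rnot_le_lt; intros Hle; nra. }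
    intros n m H1 H2. specialize (Hn n H1) as A. specialize (Hn m H2) as B.
    unfold Rdist. apply Rabs_def2 in A. apply Rabs_def2 in B. apply Rabs_def1; lra. }
  assert (Hre : forall x, Cauchy_crit (fun n => re (F n x))).
  { apply Hc. intros a b. unfold Cnorm2; simpl. pose proof (Rle_0_sqr (im a - im b)).
    unfold Rsqr in *. lra. }
  assert (Him : forall x, Cauchy_crit (fun n => im (F n x))).
  { apply Hc. intros a b. unfold Cnorm2; simpl. pose proof (Rle_0_sqr (re a - re b)).
    unfold Rsqr in *. lra. }
  exists (fun x => mkC (proj1_sig (R_complete _ (Hre x))) (proj1_sig (R_complete _ (Him x)))).
  intros k L HL. set (f := fun x => _).
  apply (Un_cv_le_eventually (fun n => nrm2 (fun x => Csub (F n x) (F k x)) L) _ _ k).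
  - clear HL. unfold nrm2. induction L as [|a L IH]; simpl.
    + intros d Hd. exists 0%nat. intros. unfold Rdist. rewrite Rminus_diag, Rabs_R0. lra.
    + apply CV_plus; [|exact IH].
      apply (Un_cv_Cnorm2 (fun n => F n a)); unfold f; simpl;
        [exact (proj2_sig (R_complete _ (Hre a)))|exact (proj2_sig (R_complete _ (Him a)))].
  - intros n Hn. auto.
Qed.

End Sums.

(** * The Jacobi operator *)

Section Tree.
Variables (V : Type) (lvl : V -> nat) (par : V -> V) (kids : V -> list V)
  (lam beta : V -> R).
Hypothesis tree : leveled_tree lvl par kids.
Hypothesis lam_pos : forall x, 0 < lam x.

Local Notation J := (Japp par kids lam beta).

Lemma lvl_par x : lvl (par x) = S (lvl x).
Proof. apply tree. Qed.

Lemma in_kids x y : In y (kids x) <-> par y = x.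
Proof. apply tree. Qed.

Lemma lvl_kids x y : In y (kids x) -> lvl x = S (lvl y).
Proof. intros H. apply in_kids in H. subst. apply lvl_par. Qed.

Lemma lvl_iter n x : lvl (Nat.iter n par x) = (n + lvl x)%nat.
Proof. induction n; simpl; [reflexivity|]. now rewrite lvl_par, IHn. Qed.

(** Induction upwards along the levels. Level 0 is the base case, since [kids] is empty there. *)
Lemma lvl_ind (P : V -> Prop) :
  (forall x, (forall y, In y (kids x) -> P y) -> P x) -> forall x, P x.
Proof.
  intros H. assert (K : forall n x, lvl x = n -> P x).
  { induction n as [n IH] using Wf_nat.lt_wf_ind. intros x Hx. apply H. intros y Hy.
    apply lvl_kids in Hy. apply (IH (lvl y)); lia. }
  intros x. now apply (K (lvl x)).
Qed.

Lemma lam_neq0 x : RtoC (lam x) <> C0.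
Proof. apply RtoC_neq0, lam_pos. Qed.

Lemma J_ext f g x : f x = g x -> f (par x) = g (par x) ->
  (forall y, In y (kids x) -> f y = g y) -> J f x = J g x.
Proof.
  intros H1 H2 H3. unfold Japp. rewrite H1, H2. f_equal.
  apply Csum_ext. intros y Hy. now rewrite H3.
Qed.

Lemma J_scal c f x : J (fun y => Cmul c (f y)) x = Cmul c (J f x).
Proof.
  unfold Japp. rewrite (Csum_ext _ (fun y => Cmul c (Cmul (RtoC (lam y)) (f y))))
    by (intros; ring).
  rewrite Csum_scal. ring.
Qed.

Lemma J_sub f g x : J (fun y => Csub (f y) (g y)) x = Csub (J f x) (J g x).
Proof.
  unfold Japp. rewrite (Csum_ext _ (fun y => Csub (Cmul (RtoC (lam y)) (f y))
    (Cmul (RtoC (lam y)) (g y)))) by (intros; ring).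
  rewrite Csum_sub. ring.
Qed.

Lemma J_conj f x : J (fun y => Cconj (f y)) x = Cconj (J f x).
Proof.
  unfold Japp. rewrite (Csum_ext _ (fun y => Cconj (Cmul (RtoC (lam y)) (f y)))).
  - rewrite Csum_conj. apply Cplx_ext; simpl; ring.
  - intros. apply Cplx_ext; simpl; ring.
Qed.

(** Only finitely many neighbours enter [J p x], so evaluation of [J] at a fixed vertex is
    continuous in the l2 norm although [J] may be unbounded. This carries the equation through an l2
    limit. *)
Lemma J_bound x : exists C, 0 <= C /\ forall p e,
  (forall L, NoDup L -> nrm2 p L <= e) -> Cnorm2 (J p x) <= C * e.
Proof.
  exists (4 * Cnorm2 (RtoC (lam x)) + 4 * Cnorm2 (RtoC (beta x)) +
          2 * nrm2 (fun y => RtoC (lam y)) (kids x)).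
  pose proof (Cnorm2_ge0 (RtoC (lam x))) as Hl. pose proof (Cnorm2_ge0 (RtoC (beta x))) as Hb.
  pose proof (nrm2_ge0 (fun y => RtoC (lam y)) (kids x)) as Hk.
  split; [lra|]. intros p e He.
  assert (Hpt : forall y, Cnorm2 (p y) <= e).
  { intros y. specialize (He [y]). unfold nrm2 in He; simpl in He.
    rewrite Rplus_0_r in He. apply He. repeat constructor; simpl; auto. }
  unfold Japp.
  eapply Rle_trans; [apply Cnorm2_add_le|].
  pose proof (Cnorm2_add_le (Cmul (RtoC (lam x)) (p (par x))) (Cmul (RtoC (beta x)) (p x))).
  pose proof (Cauchy_Schwarz (fun y => RtoC (lam y)) p (kids x)) as Hcs.
  rewrite !Cnorm2_mul in H.
  assert (nrm2 p (kids x) <= e) by (apply He, tree).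
  pose proof (Rmult_le_compat_l _ _ _ Hl (Hpt (par x))).
  pose proof (Rmult_le_compat_l _ _ _ Hb (Hpt x)).
  pose proof (Rmult_le_compat_l _ _ _ Hk H0).
  lra.
Qed.

(** * Green's formula and the resolvent estimate *)

Lemma flat_map_kids_NoDup L : NoDup L -> NoDup (flat_map kids L).
Proof.
  induction 1 as [|a L Ha HL IH]; simpl; [constructor|].
  apply NoDup_app; [apply tree|exact IH|]. intros y Hy Hy'.
  apply in_flat_map in Hy'. destruct Hy' as (b & Hb & Hyb).
  apply in_kids in Hy. apply in_kids in Hyb. congruence.
Qed.

Lemma in_flat_map_kids L y : In y (flat_map kids L) <-> In (par y) L.
Proof.
  rewrite in_flat_map. split.
  - intros (x & Hx & Hy). apply in_kids in Hy. now subst.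
  - intros H. exists (par y). split; [exact H|]. now apply in_kids.
Qed.

Lemma Csum_flat_map f L :
  Csum_list (fun x => Csum_list f (kids x)) L = Csum_list f (flat_map kids L).
Proof. induction L as [|a L IH]; simpl; [reflexivity|]. now rewrite Csum_app, IH. Qed.

(** [L] also contains the neighbours of the support, so [J f] vanishes outside [L] as well and sums
    over [L] miss no edge term. *)
Definition nbhd_supp (L : list V) (f : V -> Cplx) : Prop :=
  forall x, f x <> C0 -> In x L /\ In (par x) L /\ incl (kids x) L.

Lemma nbhd_supp_exists f : finsupp f -> exists L, NoDup L /\ nbhd_supp L f.
Proof.
  intros [S HS]. exists (nodup dec_eq (S ++ map par S ++ flat_map kids S)).
  split; [apply NoDup_nodup|]. intros x Hx.
  assert (Hi : In x S) by (apply NNPP; auto).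
  split; [|split].
  - apply nodup_In, in_or_app. auto.
  - apply nodup_In, in_or_app. right. apply in_or_app. left. now apply in_map.
  - intros y Hy. apply nodup_In, in_or_app. right. apply in_or_app. right.
    apply in_flat_map. eauto.
Qed.

Lemma nbhd_supp_incl L M f : incl L M -> nbhd_supp L f -> nbhd_supp M f.
Proof.
  intros Hi H x Hx. destruct (H x Hx) as (A & B & C).
  split; [|split]; auto. intros y Hy. auto.
Qed.

Lemma nbhd_supp_out L f x : nbhd_supp L f -> ~ In x L -> f x = C0.
Proof. intros H Hx. apply NNPP. intros Hf. destruct (H x Hf); auto. Qed.

Lemma J_out L f x : nbhd_supp L f -> ~ In x L -> J f x = C0.
Proof.
  intros H Hx. transitivity (J (fun _ => C0) x).
  - apply J_ext.
    + apply (nbhd_supp_out L); auto.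
    + apply NNPP. intros Hf. destruct (H _ Hf) as (_ & _ & C). apply Hx, C.
      now apply in_kids.
    + intros y Hy. apply NNPP. intros Hf. destruct (H _ Hf) as (_ & B & _).
      apply in_kids in Hy. subst. auto.
  - unfold Japp. rewrite (Csum_ext _ (fun _ => C0)) by (intros; ring).
    rewrite Csum_zero by auto. ring.
Qed.

(** Every edge from y to [par y] carries the same real weight in both directions, so both sides
    collect the same edge terms [E] and [E']. Sums over all kids become sums over [flat_map kids L],
    which differs from [L] only where the terms vanish. The pairing is bilinear, and [g] may have
    infinite support. *)
Lemma Green L f g : NoDup L -> nbhd_supp L f ->
  Csum_list (fun x => Cmul (J f x) (g x)) L = Csum_list (fun x => Cmul (f x) (J g x)) L.
Proof.
  intros HL Hf.
  set (E := fun y => Cmul (RtoC (lam y)) (Cmul (f y) (g (par y)))).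
  set (E' := fun y => Cmul (RtoC (lam y)) (Cmul (f (par y)) (g y))).
  set (D := fun y => Cmul (RtoC (beta y)) (Cmul (f y) (g y))).
  assert (HE : Csum_list E (flat_map kids L) = Csum_list E L).
  { apply Csum_supp; auto using flat_map_kids_NoDup. intros y Hy.
    assert (Hn : f y <> C0) by (intros e; apply Hy; unfold E; rewrite e; ring).
    rewrite in_flat_map_kids. destruct (Hf y Hn) as (A & B & _). tauto. }
  assert (HE' : Csum_list E' (flat_map kids L) = Csum_list E' L).
  { apply Csum_supp; auto using flat_map_kids_NoDup. intros y Hy.
    assert (Hn : f (par y) <> C0) by (intros e; apply Hy; unfold E'; rewrite e; ring).
    rewrite in_flat_map_kids. destruct (Hf _ Hn) as (A & _ & C).
    assert (In y L) by (apply C; now apply in_kids). tauto. }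
  transitivity (Csum_list (fun x => Cadd (Cadd (E' x) (D x)) (Csum_list E (kids x))) L).
  - apply Csum_ext. intros x _. unfold Japp.
    rewrite (Csum_ext E (fun y => Cmul (g x) (Cmul (RtoC (lam y)) (f y)))).
    + rewrite Csum_scal. unfold E', D. ring.
    + intros y Hy. apply in_kids in Hy. unfold E. rewrite Hy. ring.
  - rewrite !Csum_add, Csum_flat_map, HE. symmetry.
    transitivity (Csum_list (fun x => Cadd (Cadd (E x) (D x)) (Csum_list E' (kids x))) L).
    + apply Csum_ext. intros x _. unfold Japp.
      rewrite (Csum_ext E' (fun y => Cmul (f x) (Cmul (RtoC (lam y)) (g y)))).
      * rewrite Csum_scal. unfold E, D. ring.
      * intros y Hy. apply in_kids in Hy. unfold E'. rewrite Hy. ring.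
    + rewrite !Csum_add, Csum_flat_map, HE'. ring.
Qed.

(** By [Green] with the conjugate of [f], the sum of J f times conj f is real; the imaginary part
    comes from the term in z alone. *)
Lemma energy L f z : NoDup L -> nbhd_supp L f ->
  im z * nrm2 f L =
  - im (Csum_list (fun x => Cmul (Csub (J f x) (Cmul z (f x))) (Cconj (f x))) L).
Proof.
  intros HL Hf.
  rewrite (Csum_ext _ (fun x => Csub (Cmul (J f x) (Cconj (f x)))
    (Cmul z (RtoC (Cnorm2 (f x))))))
    by (intros; apply Cplx_ext; unfold Cnorm2; simpl; ring).
  rewrite Csum_sub, Csum_scal.
  pose proof (Green L f (fun x => Cconj (f x)) HL Hf) as G.
  rewrite (Csum_ext (fun x => Cmul (f x) (J (fun y => Cconj (f y)) x))
    (fun x => Cconj (Cmul (J f x) (Cconj (f x))))) in G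
    by (intros; rewrite J_conj; apply Cplx_ext; simpl; ring).
  rewrite Csum_conj in G. apply (f_equal im) in G. simpl in G.
  rewrite Csum_RtoC. simpl. unfold nrm2. lra.
Qed.

(** With b = Im z and g = (J - z) f, [energy] gives b^2 |f|^2 as a sum of -b Im (g conj f), each
    term at most |g|^2 / 2 + b^2 |f|^2 / 2; the second half is absorbed on the left. *)
Lemma resolvent_bound L f z : NoDup L -> nbhd_supp L f ->
  im z * im z * nrm2 f L <= nrm2 (fun x => Csub (J f x) (Cmul z (f x))) L.
Proof.
  intros HL Hf. pose proof (energy L f z HL Hf) as E. rewrite Csum_im in E.
  set (b := im z) in *. set (g := fun x => Csub (J f x) (Cmul z (f x))) in *.
  assert (H : Rsum_list (fun x => - b * im (Cmul (g x) (Cconj (f x)))) L <=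
    Rsum_list (fun x => / 2 * Cnorm2 (g x) + (b * b / 2) * Cnorm2 (f x)) L).
  { apply Rsum_le. intros x _. generalize (g x) (f x). clear. intros p q.
    unfold Cnorm2. simpl.
    pose proof (Rle_0_sqr (im p + b * re q)).
    pose proof (Rle_0_sqr (re p - b * im q)). unfold Rsqr in *. lra. }
  rewrite Rsum_scal, Rsum_lin in H. fold (nrm2 g L) in H. fold (nrm2 f L) in H.
  change (Rsum_list (fun x => im (Cmul (g x) (Cconj (f x)))) L) with
    (Rsum_list (fun x => im (Cmul (Csub (J f x) (Cmul z (f x))) (Cconj (f x)))) L) in H.
  set (Q := Rsum_list _ L) in *.
  assert (b * (b * nrm2 f L) = b * - Q) by (now rewrite E). lra.
Qed.

(** * Solutions of [(J - z) f = g] *)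

(** Recursion with fuel: [S (lvl x)] at [x] leaves exactly [S (lvl y)] at a kid [y], so the default
    [C0] is never reached. *)
Lemma lvl_rec (G k : V -> Cplx -> Cplx) :
  exists r, forall x, r x = G x (Csum_list (fun y => k y (r y)) (kids x)).
Proof.
  set (F := fix F n x := match n with
    | 0%nat => C0
    | S n => G x (Csum_list (fun y => k y (F n y)) (kids x)) end).
  exists (fun x => F (S (lvl x)) x). intros x. simpl. f_equal.
  apply Csum_ext. intros y Hy. now rewrite (lvl_kids x y Hy).
Qed.

(** The second clause is [J phi = z phi] at [x] divided by [phi x]. *)
Definition is_ratio (z : Cplx) (r : V -> Cplx) : Prop :=
  (forall x, r x <> C0) /\ forall x,
  Cadd (Cadd (Cmul (RtoC (lam x)) (r x)) (RtoC (beta x)))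
    (Csum_list (fun y => Cdiv (RtoC (lam y)) (r y)) (kids x)) = z.

(* A continued fraction in which [Im z * Im (r x) > 0] propagates upwards from level 0. *)
Lemma ratio_exists z : im z <> 0 -> exists r, is_ratio z r.
Proof.
  intros Hz.
  destruct (lvl_rec (fun x s => Cdiv (Csub (Csub z (RtoC (beta x))) s) (RtoC (lam x)))
    (fun y c => Cdiv (RtoC (lam y)) c)) as [r Hr].
  exists r. assert (H : forall x,
    Cadd (Cadd (Cmul (RtoC (lam x)) (r x)) (RtoC (beta x)))
    (Csum_list (fun y => Cdiv (RtoC (lam y)) (r y)) (kids x)) = z).
  { intros x. rewrite (Hr x) at 1. field. apply lam_neq0. }
  (* Inversion flips the sign of the imaginary part, so the sum over the kids contributes at most 0
     to Im z times the imaginary part of the equation; what remains is lam x * Im z * Im (r x) >=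
     (Im z)^2 > 0. Since [Cinv] is total, [r] could be defined before being known nonzero. *)
  assert (Hp : forall x, 0 < im z * im (r x)).
  { apply lvl_ind. intros x IH. specialize (H x). apply (f_equal im) in H. simpl in H.
    rewrite Csum_im in H.
    assert (Hs : im z * Rsum_list (fun y => im (Cdiv (RtoC (lam y)) (r y))) (kids x) <= 0).
    { rewrite <- Rsum_scal. rewrite <- (Rmult_0_l (Rsum_list (fun _ => 0) (kids x))).
      rewrite <- Rsum_scal. apply Rsum_le. intros y Hy. specialize (IH y Hy). simpl.
      assert (Hn : 0 < Cnorm2 (r y)).
      { apply Cnorm2_gt0. intros e. rewrite e in IH. simpl in IH. lra. }
      pose proof (Rmult_lt_0_compat _ _ (lam_pos y) (Rdiv_lt_0_compat _ _ IH Hn)).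
      replace (im z * (lam y * (- im (r y) / Cnorm2 (r y)) + 0 * (re (r y) / Cnorm2 (r y))))
        with (- (lam y * (im z * im (r y) / Cnorm2 (r y)))) by (field; lra). lra. }
    assert (0 < im z * im z) by nra.
    pose proof (lam_pos x).
    assert (0 < lam x * (im z * im (r x))).
    { set (S := Rsum_list _ _) in *. rewrite <- H in H0 at 2. nra. }
    nra. }
  split; [|exact H]. intros x e. specialize (Hp x). rewrite e in Hp. simpl in Hp. lra.
Qed.

(** Elimination from below: [r] absorbs the homogeneous equation, and the source [g] is accumulated
    upwards in [t]. This turns the second-order equation into the two first-order recursions in the
    hypotheses. *)
Lemma J_of_rec z r f t g x : is_ratio z r ->
  t x = Cdiv (Cadd (g x) (Csum_list (fun y => Cdiv (Cmul (RtoC (lam y)) (t y)) (r y)) (kids x)))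
    (RtoC (lam x)) ->
  f (par x) = Cadd (Cmul (r x) (f x)) (t x) ->
  (forall y, In y (kids x) -> f x = Cadd (Cmul (r y) (f y)) (t y)) ->
  Csub (J f x) (Cmul z (f x)) = g x.
Proof.
  intros [Hr0 Hr] Ht Hp Hk. unfold Japp.
  rewrite (Csum_ext (fun y => Cmul (RtoC (lam y)) (f y))
    (fun y => Csub (Cmul (f x) (Cdiv (RtoC (lam y)) (r y)))
                   (Cdiv (Cmul (RtoC (lam y)) (t y)) (r y)))).
  - rewrite Csum_sub, Csum_scal, Hp, Ht, <- (Hr x). field. apply lam_neq0.
  - intros y Hy. rewrite (Hk y Hy). field. apply Hr0.
Qed.

(** Upward induction: the kids' values are [d x] divided by their ratios, so the equation at [x]
    determines [d (par x)]. The product form allows [d] to vanish. *)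
Lemma eigen_ratio z r d : is_ratio z r -> (forall x, J d x = Cmul z (d x)) ->
  forall x, d (par x) = Cmul (r x) (d x).
Proof.
  intros [Hr0 Hr] Hd. apply lvl_ind. intros x IH. specialize (Hd x). unfold Japp in Hd.
  rewrite (Csum_ext (fun y => Cmul (RtoC (lam y)) (d y))
    (fun y => Cmul (d x) (Cdiv (RtoC (lam y)) (r y)))) in Hd.
  - rewrite Csum_scal in Hd. rewrite <- (Hr x) in Hd.
    replace (d (par x)) with (Cdiv (Cmul (RtoC (lam x)) (d (par x))) (RtoC (lam x)))
      by (field; apply lam_neq0).
    set (s := Csum_list _ _) in Hd.
    replace (Cmul (RtoC (lam x)) (d (par x))) with
      (Csub (Cadd (Cadd (Cmul (RtoC (lam x)) (d (par x))) (Cmul (RtoC (beta x)) (d x)))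
        (Cmul (d x) s)) (Cadd (Cmul (RtoC (beta x)) (d x)) (Cmul (d x) s))) by ring.
    rewrite Hd. field. apply lam_neq0.
  - intros y Hy. specialize (IH y Hy). apply in_kids in Hy. subst x. rewrite IH.
    field. apply Hr0.
Qed.

(** [P n x] is the product of the ratios on the first n steps up from [x]. With a common ancestor of
    [x0] and [x], [phi x] is the product along the path from [x0] divided by the one along the path
    from [x]. *)
Lemma ratio_solution (r : V -> Cplx) (x0 : V) : (forall x, r x <> C0) ->
  exists phi, (forall x, phi x <> C0) /\ forall x, phi (par x) = Cmul (r x) (phi x).
Proof.
  intros Hr.
  set (P := fix P n x := match n with
    | 0%nat => Cone | S n => Cmul (P n x) (r (Nat.iter n par x)) end).
  assert (HP0 : forall n x, P n x <> C0).
  { induction n; intros x; simpl.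
    - intros H. apply (f_equal re) in H. simpl in H. lra.
    - apply Cmul_neq0; auto. }
  assert (HPd : forall d n x, P (d + n)%nat x = Cmul (P n x) (P d (Nat.iter n par x))).
  { induction d; intros; simpl; [ring|]. rewrite IHd, Nat.iter_add. ring. }
  assert (Hex : forall x, exists nm,
    Nat.iter (fst nm) par x0 = Nat.iter (snd nm) par x).
  { intros x. destruct tree as (_ & _ & _ & _ & H).
    destruct (H x0 x) as (n & m & E). now exists (n, m). }
  apply functional_choice in Hex. destruct Hex as [nm Hnm].
  set (phi := fun x => Cdiv (P (fst (nm x)) x0) (P (snd (nm x)) x)).
  (* Independence of the common ancestor: counting levels, two choices differ by the same number d
     of steps on both paths, and these extra factors cancel. *)
  assert (Hphi : forall x n m, Nat.iter n par x0 = Nat.iter m par x ->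
    phi x = Cdiv (P n x0) (P m x)).
  { assert (K : forall x n m d, Nat.iter n par x0 = Nat.iter m par x ->
      Cdiv (P (d + n)%nat x0) (P (d + m)%nat x) = Cdiv (P n x0) (P m x)).
    { intros x n m d E. rewrite !HPd, E. field. split; apply HP0. }
    intros x n m E. unfold phi. specialize (Hnm x).
    destruct (nm x) as [n' m']; simpl in *.
    assert (Hl : (n + lvl x0 = m + lvl x)%nat) by (rewrite <- !lvl_iter; congruence).
    assert (Hl' : (n' + lvl x0 = m' + lvl x)%nat) by (rewrite <- !lvl_iter; congruence).
    destruct (Nat.le_ge_cases n n').
    - rewrite <- (K x n m (n' - n)%nat E). f_equal; f_equal; lia.
    - rewrite <- (K x n' m' (n - n')%nat Hnm). f_equal; f_equal; lia. }
  exists phi. split.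
  - intros x. unfold phi, Cdiv. apply Cmul_neq0; [apply HP0|apply Cinv_neq0, HP0].
  - intros x. rewrite (Hphi (par x) (S (fst (nm x))) (snd (nm x))).
    + unfold phi. set (n := fst (nm x)). set (m := snd (nm x)).
      assert (E : Cmul (r x) (P m (par x)) = Cmul (P m x) (r (Nat.iter m par x))).
      { replace (Cmul (P m x) (r (Nat.iter m par x))) with (P (m + 1)%nat x).
        - rewrite HPd. simpl. ring.
        - now rewrite Nat.add_1_r. }
      simpl. unfold n at 2. rewrite (Hnm x). fold m.
      replace (P m (par x)) with (Cdiv (Cmul (P m x) (r (Nat.iter m par x))) (r x))
        by (rewrite <- E; field; apply Hr).
      field. repeat split; auto.
    + simpl. rewrite Hnm. now rewrite <- Nat.iter_succ, Nat.iter_succ_r.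
Qed.

Definition is_eigenfun (z : Cplx) (phi : V -> Cplx) : Prop :=
  (forall x, phi x <> C0) /\ forall x, J phi x = Cmul z (phi x).

Lemma eigenfun_exists z (x0 : V) : im z <> 0 -> exists phi, is_eigenfun z phi.
Proof.
  intros Hz. destruct (ratio_exists z Hz) as [r Hr].
  destruct (ratio_solution r x0 (proj1 Hr)) as (phi & H0 & Hp).
  exists phi. split; [exact H0|]. intros x.
  replace (J phi x) with (Cadd (Csub (J phi x) (Cmul z (phi x))) (Cmul z (phi x))) by ring.
  rewrite (J_of_rec z r phi (fun _ => C0) (fun _ => C0) x Hr).
  - ring.
  - rewrite Csum_zero; [field; apply lam_neq0|]. intros y _. field. apply Hr.
  - rewrite Hp. ring.
  - intros y Hy. apply in_kids in Hy. subst x. rewrite Hp. ring.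
Qed.

(** [phi] and [d] have the same ratios, so their quotient is constant along upward paths, and any
    two such paths meet. *)
Lemma eigenfun_unique z phi d (x0 : V) : im z <> 0 -> is_eigenfun z phi ->
  (forall x, J d x = Cmul z (d x)) -> exists c, forall x, d x = Cmul c (phi x).
Proof.
  intros Hz [H0 Hp] Hd. destruct (ratio_exists z Hz) as [r Hr].
  pose proof (eigen_ratio z r phi Hr Hp) as Rp. pose proof (eigen_ratio z r d Hr Hd) as Rd.
  assert (Hq : forall n x, Cdiv (d (Nat.iter n par x)) (phi (Nat.iter n par x)) =
    Cdiv (d x) (phi x)).
  { induction n; intros x; simpl; [reflexivity|]. rewrite <- (IHn x), Rp, Rd.
    field. split; [apply H0|apply Hr]. }
  exists (Cdiv (d x0) (phi x0)). intros x. destruct tree as (_ & _ & _ & _ & Hc).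
  destruct (Hc x x0) as (n & m & E). rewrite <- (Hq m x0), <- E, (Hq n x).
  field. apply H0.
Qed.

(** * Finite branches of the tree *)

Definition desc (x y : V) : Prop := exists m, Nat.iter m par y = x.

Lemma desc_par x y : desc x y -> y = x \/ desc x (par y).
Proof.
  intros [[|m] H]; simpl in H; [auto|]. right. exists m.
  now rewrite <- Nat.iter_succ_r.
Qed.

Lemma desc_kid x y k : desc x y -> In k (kids y) -> desc x k.
Proof.
  intros [m H] Hk. apply in_kids in Hk. exists (S m). rewrite Nat.iter_succ_r. now rewrite Hk.
Qed.

Lemma desc_lvl x y : desc x y -> (lvl y <= lvl x)%nat.
Proof. intros [m <-]. rewrite lvl_iter. lia. Qed.

Lemma desc_list x : exists D, NoDup D /\ forall y, In y D <-> desc x y.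
Proof.
  revert x. enough (K : forall x, exists D, forall y, In y D <-> desc x y).
  { intros x. destruct (K x) as [D HD]. exists (nodup dec_eq D).
    split; [apply NoDup_nodup|]. intros y. now rewrite nodup_In. }
  apply lvl_ind. intros x IH.
  assert (HM : forall M, incl M (kids x) ->
    exists D, forall y, In y D <-> exists k, In k M /\ desc k y).
  { induction M as [|k M IHM]; intros Hi.
    - exists []. intros y. simpl. split; [tauto|]. now intros (k & [] & _).
    - destruct IHM as [D HD]; [intros a Ha; apply Hi; simpl; auto|].
      destruct (IH k) as [E HE]; [apply Hi; simpl; auto|].
      exists (E ++ D). intros y. rewrite in_app_iff, HE, HD. simpl. split.
      + intros [H|(a & Ha & H)]; [exists k; auto|exists a; auto].
      + intros (a & [<-|Ha] & H); [auto|right; exists a; auto]. }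
  destruct (HM (kids x) (fun a Ha => Ha)) as [D HD].
  exists (x :: D). intros y. simpl. rewrite HD. split.
  - intros [<-|(k & Hk & m & H)]; [exists 0%nat; reflexivity|].
    exists (S m). simpl. rewrite H. now apply in_kids.
  - intros [[|m] H]; simpl in H; [auto|]. right.
    exists (Nat.iter m par y). split; [now apply in_kids|now exists m].
Qed.

(** Repeated common ancestors; the finite branches thus exhaust the tree. *)
Lemma desc_exhaust (M : list V) (x0 : V) : exists x, forall y, In y M -> desc x y.
Proof.
  induction M as [|a M [x IH]]; [exists x0; intros y []|].
  destruct tree as (_ & _ & _ & _ & Hc). destruct (Hc a x) as (n & m & E).
  exists (Nat.iter n par a). intros y [<-|Hy]; [now exists n|].
  destruct (IH y Hy) as [k Hk]. exists (m + k)%nat. now rewrite Nat.iter_add, Hk.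
Qed.

(** A Dirichlet problem on the branch: [t] is computed upwards from level 0, then [f] downwards from
    the value 0 at [par x], which is possible because no ratio vanishes. *)
Lemma branch_solve z x D g : im z <> 0 -> (forall y, In y D <-> desc x y) ->
  exists f, (forall y, ~ In y D -> f y = C0) /\
    forall y, In y D -> Csub (J f y) (Cmul z (f y)) = g y.
Proof.
  intros Hz HD. destruct (ratio_exists z Hz) as [r Hr].
  destruct (lvl_rec (fun x s => Cdiv (Cadd (g x) s) (RtoC (lam x)))
    (fun y c => Cdiv (Cmul (RtoC (lam y)) c) (r y))) as [t Ht].
  (* The fuel [S (lvl x) - lvl y] used below is the number of steps from [y] up to [par x], so here
     the default [C0] is the boundary value. *)
  set (F := fix F n y := match n with
    | 0%nat => C0 | S n => Cdiv (Csub (F n (par y)) (t y)) (r y) end).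
  assert (HF : forall n y, F (S n) y = Cdiv (Csub (F n (par y)) (t y)) (r y)) by reflexivity.
  set (f := restr D (fun y => F (S (lvl x) - lvl y)%nat y)).
  assert (Hf : forall y, In y D -> f (par y) = Cadd (Cmul (r y) (f y)) (t y)).
  { intros y Hy. unfold f. rewrite (restr_in D _ y) by exact Hy.
    pose proof (proj1 (HD y) Hy) as Hd. pose proof (desc_lvl _ _ Hd) as Hl.
    replace (S (lvl x) - lvl y)%nat with (S (S (lvl x) - lvl (par y)))
      by (rewrite lvl_par; lia). rewrite HF.
    replace (restr D (fun y => F (S (lvl x) - lvl y)%nat y) (par y))
      with (F (S (lvl x) - lvl (par y))%nat (par y)).
    - field. apply Hr.
    - destruct (dec_in (par y) D) as [i|i].
      + now rewrite restr_in.
      + rewrite restr_out by exact i. destruct (desc_par _ _ Hd) as [->|H].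
        * rewrite lvl_par, Nat.sub_diag. reflexivity.
        * exfalso. apply i, HD, H. }
  exists f. split; [intros y Hy; now apply restr_out|].
  intros y Hy. apply (J_of_rec z r f t g y Hr); auto.
  intros k Hk. assert (In k D) by (apply HD; eapply desc_kid; [apply HD, Hy|exact Hk]).
  apply in_kids in Hk. rewrite <- Hk. auto.
Qed.

Lemma branch_nbhd_supp x D f : (forall y, In y D <-> desc x y) ->
  (forall y, ~ In y D -> f y = C0) -> nbhd_supp (par x :: D) f.
Proof.
  intros HD Hf y Hy. assert (Hi : In y D) by (apply NNPP; auto).
  split; [|split].
  - simpl; auto.
  - apply HD in Hi. destruct (desc_par _ _ Hi) as [->|H]; simpl; [auto|]. right. now apply HD.
  - intros k Hk. right. apply HD. eapply desc_kid; [apply HD, Hi|exact Hk].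
Qed.

Lemma branch_NoDup x D : NoDup D -> (forall y, In y D <-> desc x y) -> NoDup (par x :: D).
Proof.
  intros N HD. constructor; [|exact N]. intros H. apply HD, desc_lvl in H.
  rewrite lvl_par in H. lia.
Qed.

(** * Density of the range of [J - z] *)

Local Notation shift z f := (fun x => Csub (Japp par kids lam beta f%function x) (Cmul z (f%function x))).

(* On the descendants of [x], together with [par x], the functions [(J - z) f] are exactly
   those annihilated by [phi]; subtracting from [h] its component along [conj phi] costs
   [|sum h phi|^2 / sum |phi|^2], which tends to 0. *)
Lemma range_dense_finsupp z phi h eps : im z <> 0 -> is_eigenfun z phi -> ~ in_l2 phi ->
  finsupp h -> 0 < eps ->
  exists f, finsupp f /\ forall L, NoDup L ->
    nrm2 (fun x => Csub (shift z f x) (h x)) L <= eps.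
Proof.
  intros Hz [Hphi0 Hphi] Hnl [S0 HS0] He.
  assert (Hh : forall x, ~ In x (nodup dec_eq S0) -> h x = C0)
    by (intros x Hx; apply HS0; now rewrite nodup_In in Hx).
  set (S := nodup dec_eq S0) in *. assert (NS : NoDup S) by apply NoDup_nodup.
  set (K := Csum_list (fun x => Cmul (h x) (phi x)) S).
  (* The threshold makes the final error |K|^2 / N smaller than [eps]; the extra 1 keeps N positive
     and [M] nonempty even if K = 0. *)
  assert (HB : exists M, NoDup M /\ Cnorm2 K / eps + 1 < nrm2 phi M).
  { apply NNPP. intros H. apply Hnl. exists (Cnorm2 K / eps + 1). intros M HM.
    apply Rnot_lt_le. intros Hlt. apply H. now exists M. }
  destruct HB as (M & NM & HM).
  assert (HK : 0 <= Cnorm2 K / eps) by (apply Rle_mult_inv_pos; [apply Cnorm2_ge0|exact He]).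
  destruct M as [|x0 M0] eqn:EM; [unfold nrm2 in HM; simpl in HM; lra|].
  rewrite <- EM in *. clear M0 EM.
  destruct (desc_exhaust (M ++ S) x0) as [x Hx].
  destruct (desc_list x) as (D & ND & HD).
  set (X := par x :: D). assert (NX : NoDup X) by (now apply branch_NoDup).
  assert (HSX : incl S X).
  { intros y Hy. right. apply HD, Hx, in_or_app. auto. }
  assert (HN : Cnorm2 K / eps + 1 < nrm2 phi X).
  { eapply Rlt_le_trans; [exact HM|]. apply nrm2_incl; [exact NM|].
    intros y Hy. right. apply HD, Hx, in_or_app. auto. }
  set (N := nrm2 phi X) in *. assert (HN0 : 0 < N) by lra.
  assert (HNC : RtoC N <> C0) by (now apply RtoC_neq0).
  set (kap := Cdiv K (RtoC N)).
  set (g := fun y => Csub (h y) (Cmul kap (Cconj (phi y)))).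
  destruct (branch_solve z x D g Hz HD) as (f & Hf0 & Hf).
  assert (Hsupp : nbhd_supp X f) by (now apply branch_nbhd_supp).
  (* [kap] makes the sum of g phi vanish, and [Green] with J phi = z phi does the same for (J - z)
     f. As the two functions agree on [D], the one remaining term, at [par x], is 0, and
     [phi (par x)] can be cancelled. *)
  assert (Hsum : Csum_list (fun y => Cmul (Csub (shift z f y) (g y)) (phi y)) X = C0).
  { rewrite (Csum_ext _ (fun y => Csub (Csub (Cmul (J f y) (phi y)) (Cmul z (Cmul (f y) (phi y))))
      (Csub (Cmul (h y) (phi y)) (Cmul kap (RtoC (Cnorm2 (phi y)))))))
      by (intros; unfold g; apply Cplx_ext; unfold Cnorm2; simpl; ring).
    rewrite !Csum_sub, !Csum_scal, Green by assumption.
    rewrite (Csum_ext (fun y => Cmul (f y) (J phi y)) (fun y => Cmul z (Cmul (f y) (phi y))))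
      by (intros; rewrite Hphi; ring).
    rewrite Csum_scal, Csum_RtoC. fold (nrm2 phi X). fold N.
    replace (Csum_list (fun y => Cmul (h y) (phi y)) X) with K.
    - unfold kap. field. exact HNC.
    - apply Csum_supp; auto. intros y Hy. split; [apply HSX|]. intros _.
      apply NNPP. intros H. apply Hy. rewrite Hh by exact H. ring. }
  simpl in Hsum. rewrite (Csum_zero _ D) in Hsum
    by (intros y Hy; rewrite Hf by exact Hy; ring).
  assert (Htop : Csub (shift z f (par x)) (g (par x)) = C0).
  { apply (Cmul_eq0 _ (phi (par x))); [|apply Hphi0]. rewrite <- Hsum. ring. }
  assert (HX : forall y, In y X -> Csub (shift z f y) (h y) = Cmul (Copp kap) (Cconj (phi y))).
  { intros y [<-|Hy].
    - replace (h (par x)) with (Cadd (g (par x)) (Cmul kap (Cconj (phi (par x)))))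
        by (unfold g; ring).
      transitivity (Csub (Csub (shift z f (par x)) (g (par x)))
        (Cmul kap (Cconj (phi (par x))))); [ring|]. rewrite Htop. ring.
    - simpl. rewrite Hf by exact Hy. unfold g. ring. }
  exists f. split; [now exists D|]. intros L HL.
  eapply Rle_trans; [apply (nrm2_supp _ X); [exact HL|]|].
  - intros y Hy. rewrite (J_out X f y Hsupp Hy), (nbhd_supp_out X f y Hsupp Hy).
    rewrite Hh by (intros H; now apply Hy, HSX). ring.
  - rewrite (nrm2_ext _ _ X HX), nrm2_scal, nrm2_conj. fold N.
    replace (Cnorm2 (Copp kap) * N) with (Cnorm2 K / N)
      by (unfold kap, Cdiv, Cnorm2; simpl; unfold Cnorm2; simpl; field; lra).
    apply (Rmult_le_reg_r N); [exact HN0|].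
    replace (Cnorm2 K / N * N) with (Cnorm2 K / eps * eps) by (field; lra).
    rewrite (Rmult_comm eps). apply Rmult_le_compat_r; lra.
Qed.

Lemma range_dense z phi h eps : im z <> 0 -> is_eigenfun z phi -> ~ in_l2 phi ->
  in_l2 h -> 0 < eps ->
  exists f, finsupp f /\ forall L, NoDup L ->
    nrm2 (fun x => Csub (shift z f x) (h x)) L <= eps.
Proof.
  intros Hz Hphi Hnl Hh He.
  destruct (l2_tail h (eps / 4) Hh) as (M & NM & HM); [lra|].
  destruct (range_dense_finsupp z phi (restr M h) (eps / 4)) as (f & Ff & Hf); auto; [|lra|].
  - exists M. intros x Hx. now apply restr_out.
  - exists f. split; [exact Ff|]. intros L HL.
    pose proof (nrm2_tri (shift z f) (restr M h) h L).
    specialize (HM L HL). specialize (Hf L HL). lra.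
Qed.

(** * Essential selfadjointness *)

Lemma finsupp_sub (f g : V -> Cplx) : finsupp f -> finsupp g -> finsupp (fun x => Csub (f x) (g x)).
Proof.
  intros [S HS] [T HT]. exists (S ++ T). intros x Hx. rewrite in_app_iff in Hx.
  rewrite HS, HT by tauto. ring.
Qed.

Lemma resolvent_bound_finsupp (f : V -> Cplx) z e : finsupp f ->
  (forall L, NoDup L -> nrm2 (shift z f) L <= e) ->
  forall L, NoDup L -> im z * im z * nrm2 f L <= e.
Proof.
  intros Hf He L HL. destruct (nbhd_supp_exists f Hf) as (M & NM & HM).
  eapply Rle_trans; [|exact (He M NM)].
  eapply Rle_trans; [|exact (resolvent_bound M f z NM HM)].
  apply Rmult_le_compat_l; [apply Rle_0_sqr|].
  apply nrm2_supp; [exact HL|]. intros x Hx. now apply (nbhd_supp_out M).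
Qed.

Lemma Jmin_sub_closure f g : Jmin par kids lam beta f g -> closure (Jmin par kids lam beta) f g.
Proof.
  intros [Hf Hg]. split; [|split].
  - now apply l2_finsupp.
  - destruct (nbhd_supp_exists f Hf) as (L & _ & HL). apply l2_finsupp.
    exists L. intros x Hx. rewrite Hg. now apply (J_out L).
  - intros eps He. exists f, g. split; [now split|].
    split; intros L HL; rewrite (Rsum_ext _ (fun _ => 0 * 0)), Rsum_scal; try lra;
      intros; unfold Cnorm2; simpl; ring.
Qed.

(** Test against the delta function at [x] and move [J] onto [v] by [Green]. *)
Lemma adjoint_pointwise v w : adjoint (closure (Jmin par kids lam beta)) v w ->
  forall x, J v x = w x.
Proof.
  intros (_ & _ & H) x. set (d := restr [x] (fun _ => Cone)).
  assert (Fd : finsupp d) by (exists [x]; intros y Hy; now apply restr_out).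
  destruct (H d (fun y => J d y)) as (s & H1 & H2); [now apply Jmin_sub_closure|].
  destruct (nbhd_supp_exists d Fd) as (L & NL & HL).
  apply has_sum_finsupp with (M := L) in H1; auto;
    [|intros y Hy; rewrite (J_out L) by assumption; ring].
  apply has_sum_finsupp with (M := L) in H2; auto;
    [|intros y Hy; rewrite (nbhd_supp_out L d) by assumption; ring].
  rewrite Green in H1 by assumption.
  assert (Hx : In x L).
  { refine (proj1 (HL x _)). unfold d. rewrite restr_in by (simpl; auto). intros e.
    apply (f_equal re) in e. simpl in e. lra. }
  assert (Hd : forall q, Csum_list (fun y => Cmul (d y) (q y)) L = q x).
  { intros q. rewrite (Csum_single _ L x NL Hx).
    - unfold d. rewrite restr_in by (simpl; auto). ring.
    - intros y _ Hy. unfold d. rewrite restr_out; [ring|]. simpl. intuition. }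
  rewrite Hd in H1, H2. rewrite J_conj in H1. subst s.
  apply (f_equal Cconj) in H2. unfold Cconj in H2. simpl in H2.
  rewrite !Ropp_involutive in H2. injection H2 as A B. now apply Cplx_ext.
Qed.

Lemma Un_cv_inv_S : Un_cv (fun k => / INR (S k)) 0.
Proof.
  intros e He. destruct (archimed_cor1 e He) as (N & HN & HN0). exists N. intros n Hn.
  unfold Rdist. rewrite Rminus_0_r, Rabs_right.
  - eapply Rle_lt_trans; [|exact HN]. apply Rinv_le_contravar; [now apply lt_0_INR|].
    apply le_INR. lia.
  - apply Rle_ge. left. apply Rinv_0_lt_compat, lt_0_INR. lia.
Qed.

(** Approximate h = w - z v by (J - z) F_k. The resolvent estimate makes F_k Cauchy, and its limit f
    solves (J - z) f = h. Then f - v is an l2 solution of the eigenvalue equation, a multiple of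
    [phi], hence 0. So F_k tends to v and J F_k = (J - z) F_k + z F_k to w. *)
Lemma adjoint_sub_closure z phi : im z <> 0 -> is_eigenfun z phi -> ~ in_l2 phi ->
  forall v w, adjoint (closure (Jmin par kids lam beta)) v w ->
    closure (Jmin par kids lam beta) v w.
Proof.
  intros Hz Hphi Hnl v w Ha. pose proof (adjoint_pointwise v w Ha) as HJ.
  destruct Ha as (Hv & Hw & _). split; [exact Hv|]. split; [exact Hw|].
  set (h := fun x => Csub (w x) (Cmul z (v x))).
  assert (Hh : in_l2 h).
  { apply (l2_ext (fun x => Cadd (w x) (Cmul (Copp z) (v x)))); [intros; unfold h; ring|].
    apply l2_add; [exact Hw|]. now apply l2_scal. }
  set (e := fun k => / INR (S k)).
  assert (He : forall k, 0 < e k) by (intros; apply Rinv_0_lt_compat, lt_0_INR; lia).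
  set (b := im z * im z). assert (Hb : 0 < b) by (unfold b; nra).
  (* Two errors of b / 4 * e k, each doubled by [nrm2_tri], add up to b * e k, and the resolvent
     estimate divides by b. *)
  assert (HF : forall k, exists f, finsupp f /\ forall L, NoDup L ->
    nrm2 (fun x => Csub (shift z f x) (h x)) L <= b / 4 * e k).
  { intros k. apply (range_dense z phi); auto. specialize (He k). nra. }
  apply functional_choice in HF. destruct HF as [F HF].
  destruct (l2_complete F e Un_cv_inv_S) as [f Hf].
  { intros j k L Hjk HL. apply (Rmult_le_reg_l b); [exact Hb|].
    refine (resolvent_bound_finsupp (fun x => Csub (F j x) (F k x)) z (b * e k) _ _ L HL).
    - apply finsupp_sub; apply HF.
    - clear L HL. intros L HL.
      rewrite (nrm2_ext _ (fun x => Csub (shift z (F j) x) (shift z (F k) x)))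
        by (intros; rewrite J_sub; ring).
      pose proof (nrm2_tri (shift z (F j)) h (shift z (F k)) L) as Ht.
      pose proof (proj2 (HF j) L HL) as Hj. pose proof (proj2 (HF k) L HL) as Hk.
      assert (Hs : nrm2 (fun x => Csub (h x) (shift z (F k) x)) L =
        nrm2 (fun x => Csub (shift z (F k) x) (h x)) L)
        by (apply Rsum_ext; intros; apply Cnorm2_sub_sym).
      assert (e j <= e k).
      { apply Rinv_le_contravar; [apply lt_0_INR; lia|apply le_INR; lia]. }
      cbv beta in Ht, Hj, Hk, Hs |- *. rewrite Hs in Ht. nra. }
  assert (Hlim : forall x, Csub (J f x) (Cmul z (f x)) = h x).
  { intros x. destruct (J_bound x) as (C & HC & HCb). apply Ceq_of_close. intros eps Heps.
    (* Collects the errors at [x]: 2 (2 C + 2 |z|^2) e k from replacing f by F_k, and 2 (b / 4) e k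
       from the approximation of h. *)
    set (A := 4 * C + 4 * Cnorm2 z + b / 2).
    assert (HA : 0 < A) by (pose proof (Cnorm2_ge0 z); unfold A; lra).
    destruct (Un_cv_inv_S (eps / A)) as [k Hk]; [now apply Rdiv_lt_0_compat|].
    specialize (Hk k (le_n _)). unfold Rdist in Hk. apply Rabs_def2 in Hk.
    fold (e k) in Hk. specialize (He k).
    pose proof (HCb _ _ (Hf k)) as H1. rewrite J_sub in H1.
    pose proof (proj2 (HF k) [x]) as H2. pose proof (Hf k [x]) as H3.
    unfold nrm2 in H2, H3; simpl in H2, H3. rewrite Rplus_0_r in H2, H3.
    assert (Hx1 : NoDup [x]) by (repeat constructor; simpl; auto).
    specialize (H2 Hx1). specialize (H3 Hx1).
    pose proof (Cnorm2_tri (shift z f x) (shift z (F k) x) (h x)) as T.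
    assert (T2 : Cnorm2 (Csub (shift z f x) (shift z (F k) x)) <=
      2 * Cnorm2 (Csub (J f x) (J (F k) x)) + 2 * (Cnorm2 z * Cnorm2 (Csub (f x) (F k x)))).
    { replace (Csub (shift z f x) (shift z (F k) x)) with
        (Cadd (Csub (J f x) (J (F k) x)) (Cmul (Copp z) (Csub (f x) (F k x)))) by ring.
      eapply Rle_trans; [apply Cnorm2_add_le|]. rewrite Cnorm2_mul.
      replace (Cnorm2 (Copp z)) with (Cnorm2 z) by (unfold Cnorm2; simpl; ring). lra. }
    pose proof (Rmult_le_compat_l _ _ _ (Cnorm2_ge0 z) H3) as H4.
    assert (A * e k <= eps).
    { replace eps with (A * (eps / A)) by (field; lra). apply Rmult_le_compat_l; lra. }
    unfold A in H. simpl in T, T2 |- *. lra. }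
  assert (Hfl : in_l2 f).
  { apply (l2_ext (fun x => Cadd (Csub (f x) (F 0%nat x)) (F 0%nat x))); [intros; ring|].
    apply l2_add; [|apply l2_finsupp, HF]. exists (e 0%nat). exact (Hf 0%nat). }
  assert (Hfv : forall x, f x = v x).
  { set (d := fun x => Csub (f x) (v x)).
    intros x. destruct (eigenfun_unique z phi d x Hz Hphi) as [c Hc].
    - intros y. unfold d. rewrite J_sub, HJ.
      replace (J f y) with (Cadd (h y) (Cmul z (f y))) by (rewrite <- Hlim; ring).
      unfold h. ring.
    - destruct (classic (c = C0)) as [->|Hc0].
      + specialize (Hc x). unfold d in Hc.
        replace (f x) with (Cadd (Csub (f x) (v x)) (v x)) by ring. rewrite Hc. ring.
      + exfalso. apply Hnl. apply (l2_ext (fun x => Cmul (Cinv c) (d x))).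
        * intros y. rewrite Hc. field. exact Hc0.
        * apply l2_scal. unfold d.
          apply (l2_ext (fun x => Cadd (f x) (Cmul (Copp Cone) (v x)))).
          -- intros y. apply Cplx_ext; simpl; ring.
          -- apply l2_add; [exact Hfl|now apply l2_scal]. }
  (* The first two summands bound the error for [w]; the summand 1 covers the error for [v]. *)
  intros eps Heps. set (A := b / 2 + 2 * Cnorm2 z + 1).
  assert (HA : 0 < A) by (pose proof (Cnorm2_ge0 z); unfold A; lra).
  destruct (Un_cv_inv_S (eps / A)) as [k Hk]; [now apply Rdiv_lt_0_compat|].
  specialize (Hk k (le_n _)). unfold Rdist in Hk. apply Rabs_def2 in Hk.
  fold (e k) in Hk. specialize (He k).
  assert (HAe : A * e k <= eps).
  { replace eps with (A * (eps / A)) by (field; lra). apply Rmult_le_compat_l; lra. }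
  pose proof (Rmult_le_pos _ _ (Cnorm2_ge0 z) (Rlt_le _ _ He)) as Hze.
  pose proof (Rmult_lt_0_compat _ _ Hb He) as Hbe. unfold A in HAe.
  assert (Hvk : forall L, NoDup L -> nrm2 (fun x => Csub (v x) (F k x)) L <= e k).
  { intros L HL. rewrite (nrm2_ext _ (fun x => Csub (f x) (F k x)))
      by (intros; now rewrite Hfv). auto. }
  exists (F k), (fun x => J (F k) x). split; [split; [apply HF|reflexivity]|].
  split; intros L HL.
  - eapply Rle_trans; [exact (Hvk L HL)|]. lra.
  - change (nrm2 (fun x => Csub (w x) (J (F k) x)) L <= eps).
    rewrite (nrm2_ext _ (fun x => Cadd (Cmul (Copp Cone) (Csub (shift z (F k) x) (h x)))
      (Cmul z (Csub (v x) (F k x)))))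
      by (intros; unfold h; apply Cplx_ext; simpl; ring).
    eapply Rle_trans; [apply nrm2_add_le|]. rewrite !nrm2_scal.
    replace (Cnorm2 (Copp Cone)) with 1 by (unfold Cnorm2; simpl; ring).
    pose proof (proj2 (HF k) L HL) as H1.
    pose proof (Rmult_le_compat_l _ _ _ (Cnorm2_ge0 z) (Hvk L HL)). lra.
Qed.

(** Symmetry passes to the closure: with finitely supported approximants, [Green] cancels the main
    terms, and Cauchy-Schwarz bounds the four differences [T1] to [T4]. *)
Lemma closure_sub_adjoint v w : closure (Jmin par kids lam beta) v w ->
  adjoint (closure (Jmin par kids lam beta)) v w.
Proof.
  intros (Hv & Hw & Hvw). split; [exact Hv|]. split; [exact Hw|].
  intros f g (Hf & Hg & Hfg).
  destruct (l2_prod_has_sum g v Hg Hv) as [s Hs].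
  destruct (l2_prod_has_sum f w Hf Hw) as [s' Hs'].
  enough (E : s = s') by (exists s; split; [exact Hs|now rewrite E]).
  destruct Hv as [Bv HBv], Hw as [Bw HBw], Hf as [Bf HBf], Hg as [Bg HBg].
  set (B := 1 + Rmax (Rmax Bv Bw) (Rmax Bf Bg)).
  assert (Hle : Bv <= B - 1 /\ Bw <= B - 1 /\ Bf <= B - 1 /\ Bg <= B - 1).
  { unfold B. pose proof (Rmax_l (Rmax Bv Bw) (Rmax Bf Bg)).
    pose proof (Rmax_r (Rmax Bv Bw) (Rmax Bf Bg)).
    pose proof (Rmax_l Bv Bw). pose proof (Rmax_r Bv Bw).
    pose proof (Rmax_l Bf Bg). pose proof (Rmax_r Bf Bg). lra. }
  assert (HB : 1 <= B) by (specialize (HBv [] (NoDup_nil _)); simpl in HBv; lra).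
  apply Ceq_of_close. intros eps Heps.
  (* The four terms total at most 10 B d, so the squared distance of [P] and [Q] is at most 40 B d
     <= eps / 25; the constants 1000 and 100 leave ample room. *)
  set (d := Rmin 1 (eps / (1000 * B))).
  assert (Hd : 0 < d).
  { apply Rmin_glb_lt; [lra|]. apply Rdiv_lt_0_compat; lra. }
  assert (Hd1 : d <= 1) by apply Rmin_l.
  assert (Hd2 : B * d <= eps / 1000).
  { apply (Rle_trans _ (B * (eps / (1000 * B)))).
    - apply Rmult_le_compat_l; [lra|apply Rmin_r].
    - right. field. lra. }
  destruct (Hvw d Hd) as (v' & w' & [Fv Jv] & Cv & Cw).
  destruct (Hfg d Hd) as (f' & g' & [Ff Jf] & Cf & Cg).
  destruct (Hs (eps / 100)) as (L1 & N1 & S1); [lra|].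
  destruct (Hs' (eps / 100)) as (L2 & N2 & S2); [lra|].
  destruct (nbhd_supp_exists f' Ff) as (L3 & N3 & S3).
  set (L := nodup dec_eq (L1 ++ L2 ++ L3)).
  assert (NL : NoDup L) by apply NoDup_nodup.
  assert (I1 : incl L1 L) by (intros x Hx; apply nodup_In; rewrite !in_app_iff; auto).
  assert (I2 : incl L2 L) by (intros x Hx; apply nodup_In; rewrite !in_app_iff; auto).
  assert (I3 : incl L3 L) by (intros x Hx; apply nodup_In; rewrite !in_app_iff; auto).
  specialize (S1 L NL I1). specialize (S2 L NL I2).
  pose proof (nbhd_supp_incl _ _ _ I3 S3) as S3'.
  specialize (HBv L NL). specialize (HBw L NL). specialize (HBf L NL). specialize (HBg L NL).
  specialize (Cv L NL). specialize (Cw L NL). specialize (Cf L NL). specialize (Cg L NL).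
  fold (nrm2 v L) in HBv. fold (nrm2 w L) in HBw.
  fold (nrm2 (fun x => Csub (v x) (v' x)) L) in Cv.
  fold (nrm2 (fun x => Csub (w x) (w' x)) L) in Cw.
  fold (nrm2 (fun x => Csub (f x) (f' x)) L) in Cf.
  fold (nrm2 (fun x => Csub (g x) (g' x)) L) in Cg.
  fold (nrm2 f L) in HBf. fold (nrm2 g L) in HBg.
  assert (Happ : forall p p', nrm2 p L <= B - 1 -> nrm2 (fun x => Csub (p x) (p' x)) L <= d ->
    nrm2 p' L <= 4 * B).
  { intros p p' H1 H2.
    rewrite (nrm2_ext p' (fun x => Cadd (p x) (Cmul (Copp Cone) (Csub (p x) (p' x)))))
      by (intros; apply Cplx_ext; simpl; ring).
    eapply Rle_trans; [apply nrm2_add_le|]. rewrite nrm2_scal.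
    replace (Cnorm2 (Copp Cone)) with 1 by (unfold Cnorm2; simpl; ring). lra. }
  assert (CS : forall p q a c, nrm2 p L <= a -> nrm2 q L <= c ->
    Cnorm2 (Csum_list (fun x => Cmul (p x) (Cconj (q x))) L) <= a * c).
  { intros p q a c Hp Hq.
    eapply Rle_trans; [apply (Cauchy_Schwarz p (fun x => Cconj (q x)))|]. rewrite nrm2_conj.
    apply Rmult_le_compat; auto using nrm2_ge0. }
  set (T1 := Csum_list (fun x => Cmul (Csub (g x) (g' x)) (Cconj (v x))) L).
  set (T2 := Csum_list (fun x => Cmul (g' x) (Cconj (Csub (v x) (v' x)))) L).
  set (T3 := Csum_list (fun x => Cmul (Csub (f x) (f' x)) (Cconj (w x))) L).
  set (T4 := Csum_list (fun x => Cmul (f' x) (Cconj (Csub (w x) (w' x)))) L).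
  assert (HT1 : Cnorm2 T1 <= d * B) by (apply CS; lra).
  assert (HT2 : Cnorm2 T2 <= 4 * B * d).
  { apply CS; [apply (Happ g)|]; lra. }
  assert (HT3 : Cnorm2 T3 <= d * B) by (apply CS; lra).
  assert (HT4 : Cnorm2 T4 <= 4 * B * d).
  { apply CS; [apply (Happ f)|]; lra. }
  set (P := Csum_list (fun x => Cmul (g x) (Cconj (v x))) L) in *.
  set (Q := Csum_list (fun x => Cmul (f x) (Cconj (w x))) L) in *.
  assert (HPQ : Csub P Q = Cadd (Cadd T1 T2) (Cmul (Copp Cone) (Cadd T3 T4))).
  { assert (G : Csum_list (fun x => Cmul (g' x) (Cconj (v' x))) L =
      Csum_list (fun x => Cmul (f' x) (Cconj (w' x))) L).
    { rewrite (Csum_ext _ (fun x => Cmul (J f' x) (Cconj (v' x))))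
        by (intros; now rewrite Jf).
      rewrite Green by assumption. apply Csum_ext. intros x _. now rewrite J_conj, Jv. }
    assert (HP : P = Cadd (Cadd T1 T2) (Csum_list (fun x => Cmul (g' x) (Cconj (v' x))) L)).
    { unfold P, T1, T2. rewrite <- !Csum_add. apply Csum_ext.
      intros; apply Cplx_ext; simpl; ring. }
    assert (HQ : Q = Cadd (Cadd T3 T4) (Csum_list (fun x => Cmul (f' x) (Cconj (w' x))) L)).
    { unfold Q, T3, T4. rewrite <- !Csum_add. apply Csum_ext.
      intros; apply Cplx_ext; simpl; ring. }
    rewrite HP, HQ, G. apply Cplx_ext; simpl; ring. }
  pose proof (Cnorm2_add_le (Cadd T1 T2) (Cmul (Copp Cone) (Cadd T3 T4))) as H0.
  rewrite <- HPQ, Cnorm2_mul in H0.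
  replace (Cnorm2 (Copp Cone)) with 1 in H0 by (unfold Cnorm2; simpl; ring).
  pose proof (Cnorm2_add_le T1 T2). pose proof (Cnorm2_add_le T3 T4).
  pose proof (Cnorm2_tri s P s') as H3. pose proof (Cnorm2_tri P Q s') as H4.
  rewrite (Cnorm2_sub_sym s P) in H3. lra.
Qed.

Lemma not_l2_ess_selfadjoint z phi : im z <> 0 -> is_eigenfun z phi -> ~ in_l2 phi ->
  ess_selfadjoint (Jmin par kids lam beta).
Proof.
  intros Hz Hphi Hnl v w. split; [apply closure_sub_adjoint|].
  now apply (adjoint_sub_closure z phi).
Qed.

(** * Square-summability of [u] *)

Lemma l2_of_exhaustion f B (x0 : V) : (forall x D, desc x x0 -> NoDup D ->
  (forall y, In y D <-> desc x y) -> nrm2 f D <= B) -> in_l2 f.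
Proof.
  intros H. exists B. intros L HL. destruct (desc_exhaust (x0 :: L) x0) as [x Hx].
  destruct (desc_list x) as (D & ND & HD).
  eapply Rle_trans; [|apply (H x D); auto].
  - apply nrm2_incl; [exact HL|]. intros y Hy. apply HD, Hx. simpl; auto.
  - apply Hx. simpl; auto.
Qed.

(* [u - a phi] with [a := u (par x) / phi (par x)], cut off to the descendants of [x], is
   mapped by [J - z] to a fixed multiple of the delta function at [x0] plus a term
   at [par x], where it vanishes; this bounds both its norm and [a]. *)
Lemma l2_of_eigen_l2 z phi u x0 : im z <> 0 -> is_eigenfun z phi -> in_l2 phi ->
  u x0 = C0 -> (forall x, x <> x0 -> J u x = Cmul z (u x)) -> in_l2 u.
Proof.
  intros Hz [Hphi0 Hphi] [B HB] Hu0 Hu.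
  set (c := J u x0). set (b := im z * im z). assert (Hb : 0 < b) by (unfold b; nra).
  set (m := Cnorm2 c / b).
  pose proof (Cnorm2_gt0 _ (Hphi0 x0)) as Hp.
  apply (l2_of_exhaustion u (2 * m + 2 * (m / Cnorm2 (phi x0) * B)) x0).
  intros x D Hx ND HD.
  set (a := Cdiv (u (par x)) (phi (par x))).
  set (q := fun y => Csub (u y) (Cmul a (phi y))). set (psi := restr D q).
  set (X := par x :: D). assert (NX : NoDup X) by (now apply branch_NoDup).
  assert (HxD : ~ In (par x) D) by (now inversion NX).
  assert (Hsupp : nbhd_supp X psi).
  { apply branch_nbhd_supp; [exact HD|]. intros; now apply restr_out. }
  (* The choice of [a] makes q vanish at [par x], so the cut-off changes nothing on [X], and [J]
     evaluated on [D] does not notice it. *)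
  assert (HqX : forall y, In y X -> psi y = q y).
  { intros y [<-|Hy]; [|now apply restr_in]. unfold psi. rewrite restr_out by exact HxD.
    unfold q, a. field. apply Hphi0. }
  assert (HJ : forall y, In y D -> J psi y = J q y).
  { intros y Hy. apply J_ext.
    - apply HqX. simpl; auto.
    - apply HqX. destruct (desc_par x y) as [->|H]; [now apply HD|simpl; auto|].
      right. now apply HD.
    - intros k Hk. apply HqX. right. apply HD. eapply desc_kid; [apply HD, Hy|exact Hk]. }
  assert (Hshift : forall y, J q y = Csub (J u y) (Cmul z (Cmul a (phi y)))).
  { intros y. unfold q. rewrite J_sub, J_scal, Hphi. ring. }
  assert (Hx0D : In x0 D) by (now apply HD).
  pose proof (energy X psi z NX Hsupp) as E.
  (* Only [x0] survives in the energy sum: elsewhere on [D] the equation holds, and at [par x] the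
     unknown value of J psi is multiplied by psi = 0. *)
  rewrite (Csum_single _ X x0 NX) in E.
  2: { right. exact Hx0D. }
  2: { intros y [<-|Hy] Hn.
       - replace (psi (par x)) with C0 by (symmetry; now apply restr_out).
         apply Cplx_ext; simpl; ring.
       - rewrite HJ, Hshift, Hu, HqX by (simpl; auto). unfold q. ring. }
  assert (Hpsi0 : psi x0 = Cmul (Copp a) (phi x0)).
  { rewrite HqX by (simpl; auto). unfold q. rewrite Hu0. ring. }
  assert (Ec : Csub (J psi x0) (Cmul z (psi x0)) = c).
  { rewrite HJ, Hshift, Hpsi0 by exact Hx0D. unfold c. ring. }
  rewrite Ec in E.
  (* Used twice: to absorb psi(x0) in the energy identity and, as psi(x0) = - a phi(x0), to bound
     [a]. *)
  assert (Hsm : Cnorm2 (psi x0) <= nrm2 psi X).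
  { replace (Cnorm2 (psi x0)) with (nrm2 psi [x0]) by (unfold nrm2; simpl; ring).
    apply nrm2_incl; [repeat constructor; simpl; auto|]. intros y [<-|[]]. right. exact Hx0D. }
  assert (Hbn : b * nrm2 psi X <= Cnorm2 c).
  { assert (E2 : b * nrm2 psi X = - im z * im (Cmul c (Cconj (psi x0))))
      by (unfold b; rewrite Rmult_assoc, E; ring).
    assert (- im z * im (Cmul c (Cconj (psi x0))) <=
      / 2 * Cnorm2 c + / 2 * (b * Cnorm2 (psi x0))).
    { unfold b. generalize c (psi x0) (im z). clear. intros p r t. unfold Cnorm2; simpl.
      pose proof (Rle_0_sqr (im p + t * re r)).
      pose proof (Rle_0_sqr (re p - t * im r)). unfold Rsqr in *. lra. }
    pose proof (Rmult_le_compat_l _ _ _ (Rlt_le _ _ Hb) Hsm). lra. }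
  assert (Hm : nrm2 psi X <= m).
  { apply (Rmult_le_reg_l b); [exact Hb|]. unfold m.
    replace (b * (Cnorm2 c / b)) with (Cnorm2 c) by (field; lra). exact Hbn. }
  assert (Ha : Cnorm2 a <= m / Cnorm2 (phi x0)).
  { apply (Rmult_le_reg_r (Cnorm2 (phi x0))); [exact Hp|].
    replace (m / Cnorm2 (phi x0) * Cnorm2 (phi x0)) with m by (field; lra).
    rewrite Hpsi0, Cnorm2_mul in Hsm.
    replace (Cnorm2 (Copp a)) with (Cnorm2 a) in Hsm by (unfold Cnorm2; simpl; ring). lra. }
  rewrite (nrm2_ext u (fun y => Cadd (psi y) (Cmul a (phi y)))).
  - eapply Rle_trans; [apply nrm2_add_le|]. rewrite nrm2_scal.
    assert (nrm2 psi D <= nrm2 psi X)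
      by (apply nrm2_incl; [exact ND|intros y Hy; right; exact Hy]).
    assert (Cnorm2 a * nrm2 phi D <= m / Cnorm2 (phi x0) * B).
    { apply Rmult_le_compat; auto using Cnorm2_ge0, nrm2_ge0. exact (HB D ND). }
    lra.
  - intros y Hy. rewrite HqX by (right; exact Hy). unfold q. ring.
Qed.

End Tree.

Theorem theorem5 (V : Type) (lvl : V -> nat) (par : V -> V) (kids : V -> list V)
  (lam beta : V -> R) :
  leveled_tree lvl par kids ->
  (forall x, 0 < lam x) ->
  ~ ess_selfadjoint (Jmin par kids lam beta) ->
  forall (x0 : V) (z : Cplx) (u : V -> Cplx),
    lvl x0 = 0%nat ->
    im z <> 0 ->
    (exists x, u x <> C0) ->
    u x0 = C0 ->
    (forall x, x <> x0 -> Japp par kids lam beta u x = Cmul z (u x)) ->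
    in_l2 u.
Proof.
  intros tree lam_pos Hne x0 z u _ Hz _ Hu0 Hu.
  destruct (eigenfun_exists V lvl par kids lam beta tree lam_pos z x0 Hz) as [phi Hphi].
  apply (l2_of_eigen_l2 V lvl par kids lam beta tree z phi u x0); auto.
  apply NNPP. intros Hnl. apply Hne.
  now apply (not_l2_ess_selfadjoint V lvl par kids lam beta tree lam_pos z phi).
Qed.
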